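(* Let $d$ be an integer with $|d|>1$, let $f:A\to A$ be a covering map of degree $d$ of the open annulus $A=(0,1)\times S^1$, and assume that there exists a trivial free connector $C$ for $f$. Then there exists a semiconjugacy between $f$ and $m_d$ on $S^1$.
   Context: $m_d:S^1\to S^1$, $m_d(z)=z^d$. A semiconjugacy between $f$ and $m_d$ is a continuous map $h:A\to S^1$ with $hf=m_dh$ such that $h_*:H_1(A,\mathbb{Z})\to H_1(S^1,\mathbb{Z})$ is an isomorphism. The degree of $f$ is the integer $d$ such that $f_*$ is multiplication by $d$ on $H_1(A,\mathbb{Z})\cong\mathbb{Z}$. An open set $U\subset A$ is essential if the map $H_1(U,\mathbb{Z})\to H_1(A,\mathbb{Z})=\mathbb{Z}$ induced by inclusion is onto; a subset $X\subset A$ is essential if every open neighbourhood of $X$ in $A$ is essential. A connector is a connected closed subset $C$ of $A$ having accumulation points in both components of the boundary of $A$, i.e. for every $r>0$ there are $(x,y),(x',y')\in C$ with $x<r$ and $x'>1-r$. A connector is trivial if it is not essential. A connector $C$ is free for $f$ if $f(C)\cap C=\emptyset$. *)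

(* Defs.v *)
From HB Require Import structures.
From mathcomp Require Import all_boot all_order all_algebra.
From mathcomp Require Import generic_quotient ring_quotient.
From mathcomp Require Import all_classical all_reals all_analysis.
From mathcomp Require Import complex freeg.

Set Implicit Arguments.
Unset Strict Implicit.
Unset Printing Implicit Defensive.

Import Order.TTheory GRing.Theory Num.Theory.
Import numFieldNormedType.Exports.

Local Open Scope classical_set_scope.
Local Open Scope ring_scope.
Local Open Scope quotient_scope.

(** * Singular homology in degree one *)

Definition simplex (R : realType) (n : nat) : set 'rV[R]_n.+1 :=
  [set t | (forall i, 0 <= t ord0 i) /\ \sum_i t ord0 i = 1].
Arguments simplex : clear implicits.

Section Faces.
Context (R : realType) (n : nat) (i : 'I_n.+2).

(* Inserts a zero barycentric coordinate at position [i]. *)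
Definition face_row (t : 'rV[R]_n.+1) : 'rV[R]_n.+2 :=
  \row_j (if unlift i j is Some k then t ord0 k else 0).

Lemma face_row_simplex (t : simplex R n) : face_row (\val t) \in simplex R n.+1.
Proof.
case: t => t /= /set_mem[t0 t1]; apply/mem_set; split=> [j|].
  by rewrite mxE; case: unliftP.
rewrite (bigD1_ord i) //= mxE unlift_none add0r -t1.
by apply: eq_bigr => k _; rewrite mxE liftK.
Qed.

Definition face_fun (t : simplex R n) : simplex R n.+1 :=
  exist _ (face_row (\val t)) (face_row_simplex t).

Lemma face_fun_continuous : continuous face_fun.
Proof.
apply: continuous_comp_initial => t U [P Pt PU].
suff : \forall s \near t, forall j k, P j k (face_row (\val s) j k).
  by apply: filterS => s Ps; exact: PU.
apply: (@filter_forall _ _ (fun j (s : simplex R n) =>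
  forall k, P j k (face_row (\val s) j k)) (nbhs t)) => j.
apply: (@filter_forall _ _ (fun k (s : simplex R n) =>
  P j k (face_row (\val s) j k)) (nbhs t)) => k.
suff : {for t, continuous (fun s : simplex R n => face_row (\val s) j k)}.
  by apply; exact: Pt.
have -> : (fun s : simplex R n => face_row (\val s) j k) =
    (fun s : simplex R n => if unlift i k is Some l then (\val s) ord0 l else 0).
  by apply/funext => s; rewrite mxE.
case: unliftP => [l _|_]; last exact: cst_continuous.
apply: (@continuous_comp _ _ _ (fun s : simplex R n => \val s)
  (fun M : 'rV[R]_n.+1 => M ord0 l)).
  exact: initial_continuous.
exact: coord_continuous.
Qed.

Definition face : continuousType (simplex R n) (simplex R n.+1) :=
  mkcts face_fun_continuous.

End Faces.

Section Chains.
Context (R : realType).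
Implicit Types (X Y : topologicalType) (n : nat).

Definition singular n X := continuousType (simplex R n) X.

Definition chain n X := {freeg (singular n X)}.

Definition boundary n X : chain n.+1 X -> chain n X :=
  fglift (fun s : singular n.+1 X =>
    \sum_(i < n.+2) (-1) ^+ i *: << (s \o face R i : singular n X) >>).

Definition chain_map n X Y (g : continuousType X Y) : chain n X -> chain n Y :=
  fglift (fun s : singular n X => << (g \o s : singular n Y) >>).

Lemma boundary_is_additive n X : additive (@boundary n X).
Proof. exact: lift_is_additive. Qed.

HB.instance Definition _ n X := GRing.isAdditive.Build
  (chain n.+1 X) (chain n X) (@boundary n X) (@boundary_is_additive n X).

Lemma chain_map_is_additive n X Y (g : continuousType X Y) :
  additive (@chain_map n X Y g).
Proof. exact: lift_is_additive. Qed.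

HB.instance Definition _ n X Y (g : continuousType X Y) := GRing.isAdditive.Build
  (chain n X) (chain n Y) (@chain_map n X Y g) (@chain_map_is_additive n X Y g).

Lemma boundary_chain_map n X Y (g : continuousType X Y) (c : chain n.+1 X) :
  boundary (chain_map g c) = chain_map g (boundary c).
Proof.
rewrite -(freeg_sumE c) !raddf_sum; apply: eq_bigr => s _ /=.
have raddfZz (U V : lmodType int) (h : {additive U -> V}) (k : int) x :
    h (k *: x) = k *: h x by rewrite -[k]intz !scaler_int raddfMz.
rewrite [in LHS]/chain_map [in X in chain_map g X]/boundary !liftU.
rewrite !raddfZz /=; congr (_ *: _).
rewrite /boundary liftU scale1r raddf_sum; apply: eq_bigr => i _ /=.
rewrite raddfZz /=; congr (_ *: _).
rewrite /chain_map liftU scale1r; congr << _ >>.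
exact/continuousEP.
Qed.

Definition is_cycle X : {pred chain 1 X} := [pred c | boundary c == 0].

Lemma is_cycle_zmod_closed X : zmod_closed (@is_cycle X).
Proof.
split=> [|c c']; rewrite !inE ?raddf0// => /eqP c0 /eqP c'0.
by rewrite raddfB/= c0 c'0 subrr.
Qed.

HB.instance Definition _ X := GRing.isZmodClosed.Build (chain 1 X) (@is_cycle X)
  (@is_cycle_zmod_closed X).

Record cycle X := Cycle { cycle_chain :> chain 1 X ; _ : cycle_chain \in @is_cycle X }.

HB.instance Definition _ X := [isSub for @cycle_chain X].
HB.instance Definition _ X := [Choice of cycle X by <:].
HB.instance Definition _ X := [SubChoice_isSubZmodule of cycle X by <:].

Definition is_boundary X : {pred cycle X} :=
  [pred z : cycle X | `[< exists b : chain 2 X, boundary b = z >]].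

Lemma is_boundary_zmod_closed X : zmod_closed (@is_boundary X).
Proof.
split=> [|z z']; first by apply/asboolP; exists 0; rewrite !raddf0.
move=> /asboolP[b bz] /asboolP[b' bz']; apply/asboolP; exists (b - b').
by rewrite !raddfB/= bz bz'.
Qed.

HB.instance Definition _ X := GRing.isZmodClosed.Build (cycle X) (@is_boundary X)
  (@is_boundary_zmod_closed X).

(* Cycles modulo boundaries, as an abelian group; coefficients are in [int],
   the default ring of [{freeg _}]. *)
Definition H1 X : zmodType := Quotient.quot (@is_boundary X).

Lemma cycle_map_subproof X Y (g : continuousType X Y) (z : cycle X) :
  chain_map g z \in @is_cycle Y.
Proof.
case: z => c /= cc; move: cc; rewrite !inE => /eqP c0.
by rewrite boundary_chain_map c0 raddf0.
Qed.

Definition cycle_map X Y (g : continuousType X Y) (z : cycle X) : cycle Y :=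
  Cycle (cycle_map_subproof g z).

Definition H1_class X (z : cycle X) : H1 X := \pi_(Quotient.quot (@is_boundary X)) z.

(* Defined on a representative cycle; [H1_mapE] shows that the choice is
   irrelevant, and [H1_map_is_additive] that it is a homomorphism, so that
   [bijective (H1_map g)] says that [g] induces an isomorphism. *)
Definition H1_map X Y (g : continuousType X Y) (u : H1 X) : H1 Y :=
  H1_class (cycle_map g (repr (u : Quotient.quot (@is_boundary X)))).

Lemma H1_class_eq X (z z' : cycle X) :
  H1_class z = H1_class z' <-> exists b : chain 2 X, boundary b = z - z' :> chain 1 X.
Proof.
split.
  move=> /eqP; rewrite -Quotient.idealrBE => /asboolP[b bz].
  by exists b; rewrite bz -[RHS]/(\val z - \val z') -raddfB.
move=> [b bz]; apply/eqP; rewrite -Quotient.idealrBE.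
by apply/asboolP; exists b; rewrite bz -[LHS]/(\val z - \val z') -raddfB.
Qed.

Lemma H1_mapE X Y (g : continuousType X Y) (z : cycle X) :
  H1_map g (H1_class z) = H1_class (cycle_map g z).
Proof.
have /H1_class_eq[b bz] : H1_class (repr (H1_class z)) = H1_class z.
  exact: reprK.
by apply/H1_class_eq; exists (chain_map g b); rewrite boundary_chain_map bz raddfB.
Qed.

Lemma H1_map_is_additive X Y (g : continuousType X Y) : additive (H1_map g).
Proof.
have classB (T : topologicalType) (z z' : cycle T) :
    H1_class (z - z') = H1_class z - H1_class z'.
  rewrite /H1_class; apply: etrans (@Quotient.pi_add _ (@is_boundary T) z (- z')) _.
  by congr (_ + _); exact: Quotient.pi_opp.
move=> u v; rewrite -[u]reprK -[v]reprK -!/(H1_class _) -classB !H1_mapE -classB.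
by congr H1_class; apply/val_inj; exact: raddfB.
Qed.

HB.instance Definition _ X Y (g : continuousType X Y) := GRing.isAdditive.Build
  (H1 X) (H1 Y) (H1_map g) (H1_map_is_additive g).

End Chains.

Arguments H1 R X : clear implicits.

(** * Covering maps *)

(* [f] restricts to a homeomorphism of the subspace [V] onto the subspace [U]. *)
Definition homeomorphic_restriction (X Y : topologicalType) (f : X -> Y)
    (V : set X) (U : set Y) : Prop :=
  exists (phi : continuousType V U) (psi : continuousType U V),
    [/\ cancel phi psi, cancel psi phi & forall x : V, \val (phi x) = f (\val x)].

(* [VV] is the family of sheets over [U]. *)
Definition evenly_covered (X Y : topologicalType) (f : X -> Y) (U : set Y) : Prop :=
  exists VV : set (set X),
    [/\ f @^-1` U = \bigcup_(V in VV) V, trivIset VV id,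
        forall V, VV V -> open V
      & forall V, VV V -> homeomorphic_restriction f V U].

Definition covering_map (X Y : topologicalType) (f : X -> Y) : Prop :=
  [/\ continuous f, (forall y, exists x, f x = y)
    & forall y, exists U, [/\ open U, U y & evenly_covered f U]].

(** * The circle and the open annulus *)

Section Annulus.
Context (R : realType).

(* [R[i]^o] is the complex field with the topology of its norm. *)
Definition unit_circle : set (R[i])^o := [set z | `|z| = 1].

Definition circle : topologicalType := unit_circle.

Definition annulus : topologicalType := ((`]0, 1[%classic : set R) * unit_circle)%type.

Lemma circle_pow_subproof (d : int) (z : unit_circle) :
  ((\val z : R[i]) ^ d : (R[i])^o) \in unit_circle.
Proof.
case: z => z /= /set_mem z1; apply/mem_set; rewrite /unit_circle /=.
by case: d => n; rewrite /exprz ?normfV normrX z1 expr1n ?invr1.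
Qed.

Definition circle_pow (d : int) (z : circle) : circle :=
  exist _ ((\val z : R[i]) ^ d : (R[i])^o) (circle_pow_subproof d z).

Definition semiconjugacy (f : annulus -> annulus) (d : int)
    (h : continuousType annulus circle) : Prop :=
  (forall p, h (f p) = circle_pow d (h p)) /\ bijective (@H1_map R _ _ h).

Definition degree (f : continuousType annulus annulus) (d : int) : Prop :=
  forall u : H1 R annulus, H1_map f u = u *~ d.

Definition inclusion (U : set annulus) : continuousType U annulus :=
  mkcts (@initial_continuous U annulus set_val).

Definition essential_open (U : set annulus) : Prop :=
  forall u : H1 R annulus, exists v : H1 R U, H1_map (inclusion U) v = u.

Definition essential (X : set annulus) : Prop :=
  forall U : set annulus, open U -> X `<=` U -> essential_open U.

Definition connector (C : set annulus) : Prop :=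
  [/\ connected C, closed C
    & forall r : R, 0 < r -> exists p q : annulus,
        [/\ C p, C q, \val p.1 < r & 1 - r < \val q.1]].

Definition free_set (f : annulus -> annulus) (C : set annulus) : Prop :=
  f @` C `&` C = set0.

End Annulus.
Arguments annulus : clear implicits.
Arguments circle : clear implicits.

(* Main.v *)
From HB Require Import structures.
From mathcomp Require Import all_boot all_order all_algebra.
From mathcomp Require Import all_classical all_reals all_analysis.
From mathcomp Require Import complex freeg.
From mathcomp Require Import ring lra zify.
Require Import Defs.

(* Lift [f] to a homeomorphism [F] of the plane, the universal cover of the
   annulus, so that [F (z + 1) = F z + d] for the deck translation.  Since [C] is
   trivial, it lifts to a connected closed set [C_0] disjoint from its translates
   [C_j]; otherwise a path in the preimage of a neighbourhood of [C], joining a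
   point to a translate of it, would cross a lift of [C] from one end of the
   strip to the other, and produce a loop of winding number 1 near [C].  For the
   same crossing reason [C_j] separates its left side from its right side, so
   that every [z] has an index [N z], the last [j] such that [z] is not to the
   left of [C_j].  The integer [N] satisfies [N (z + 1) = N z + 1] and jumps by
   at most one.  Because [C] is free, each [F C_j] lies between two consecutive
   translates, and so does each [F^-1 C_j]; comparing the two gives a uniform
   bound on [N (F z) - d * N z].  Hence [N (F^n z) / d ^ n] converges uniformly,
   to a limit which is continuous as the jumps are divided by [d ^ n], and which
   induces the semiconjugacy.  Its action on [H_1] is read off winding numbers, as
   [H_1] of the annulus is generated by the core circle. *)

Set Implicit Arguments.
Unset Strict Implicit.
Unset Printing Implicit Defensive.

Import Order.TTheory GRing.Theory Num.Theory.
Import numFieldNormedType.Exports.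

Local Open Scope classical_set_scope.
Local Open Scope ring_scope.

(** No Jordan-type theorem is invoked: every separation statement is reduced to the crossing of two
    paths in a rectangle, which is itself a statement about lifting an angle. A connector is
    connected but perhaps not path connected, so no path is ever drawn inside it. It is placed in an
    open set, a neighbourhood or the complement of what it avoids, and there its points are joined
    by paths. Sides are accordingly path components of complements. The uniform bound on the
    displacement comes from a count. Normalize to index 0 for [z]; then [F C_0] and [F C_1] have
    indices [n0] and [n0 + d]. If the index of [F z] were more than [2 |d|] away from [n0], two
    translates whose numbers differ by [|d|] would separate [F z] from both sets, and [F^-1] would
    send both translates to index 0. But [F^-1] turns a shift by [d] into a shift by 1, so these two
    indices differ by 1. The sign of [d] does not matter here, although [F] reverses the order of
    the translates when [d < 0]. *)

Section Continuity.
Context (R : realType).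

Lemma continuous_pair (X Y Z : topologicalType) (f : X -> Y) (g : X -> Z) :
  continuous f -> continuous g -> continuous (fun x => (f x, g x)).
Proof. by move=> cf cg x; apply: cvg_pair; [exact: cf|exact: cg]. Qed.

Lemma continuous_fst (X Y : topologicalType) : continuous (@fst X Y).
Proof. by move=> x; exact: cvg_fst. Qed.

Lemma continuous_snd (X Y : topologicalType) : continuous (@snd X Y).
Proof. by move=> x; exact: cvg_snd. Qed.

Lemma continuousT_comp (X Y Z : topologicalType) (f : X -> Y) (g : Y -> Z) :
  continuous f -> continuous g -> continuous (fun x => g (f x)).
Proof. by move=> cf cg x; apply: continuous_comp; [exact: cf|exact: cg]. Qed.

Lemma continuous_add2 (X : topologicalType) (f g : X -> R) :
  continuous f -> continuous g -> continuous (fun x => f x + g x).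
Proof. by move=> cf cg x; apply: cvgD; [exact: cf|exact: cg]. Qed.

Lemma continuous_opp1 (X : topologicalType) (f : X -> R) :
  continuous f -> continuous (fun x => - f x).
Proof. by move=> cf x; apply: cvgN; exact: cf. Qed.

Lemma continuous_sub2 (X : topologicalType) (f g : X -> R) :
  continuous f -> continuous g -> continuous (fun x => f x - g x).
Proof. by move=> cf cg x; apply: cvgB; [exact: cf|exact: cg]. Qed.

Lemma continuous_mul2 (X : topologicalType) (f g : X -> R) :
  continuous f -> continuous g -> continuous (fun x => f x * g x).
Proof. by move=> cf cg x; apply: cvgM; [exact: cf|exact: cg]. Qed.

Lemma continuous_max2 (X : topologicalType) (f g : X -> R) :
  continuous f -> continuous g -> continuous (fun x => Num.max (f x) (g x)).
Proof. by move=> cf cg x; apply: continuous_max; [exact: cf|exact: cg]. Qed.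

Lemma continuous_min2 (X : topologicalType) (f g : X -> R) :
  continuous f -> continuous g -> continuous (fun x => Num.min (f x) (g x)).
Proof. by move=> cf cg x; apply: continuous_min; [exact: cf|exact: cg]. Qed.

Lemma continuous_id (X : topologicalType) : continuous (fun x : X => x).
Proof. by move=> x; exact: cvg_id. Qed.

Lemma continuous_const (X Y : topologicalType) (y : Y) : continuous (fun _ : X => y).
Proof. by move=> x; exact: cvg_cst. Qed.

Lemma continuous_fst2 (X Y Z : topologicalType) (f : X -> Y * Z) :
  continuous f -> continuous (fun x => (f x).1).
Proof. by move=> cf; exact: (continuousT_comp cf (@continuous_fst _ _)). Qed.

Lemma continuous_snd2 (X Y Z : topologicalType) (f : X -> Y * Z) :
  continuous f -> continuous (fun x => (f x).2).
Proof. by move=> cf; exact: (continuousT_comp cf (@continuous_snd _ _)). Qed.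

Definition clamp (t : R) : R := Num.max 0 (Num.min t 1).

Lemma clamp_continuous : continuous clamp.
Proof.
apply: continuous_max2; first exact: continuous_const.
by apply: continuous_min2; [exact: continuous_id|exact: continuous_const].
Qed.

Lemma clamp_le0 t : t <= 0 -> clamp t = 0.
Proof. by rewrite /clamp => t0; rewrite max_l// ge_min t0. Qed.

Lemma clamp_ge1 t : 1 <= t -> clamp t = 1.
Proof. by rewrite /clamp => t1; rewrite (min_r t1) max_r. Qed.

Lemma clamp_id t : 0 <= t <= 1 -> clamp t = t.
Proof. by rewrite /clamp => /andP[t0 t1]; rewrite (min_l t1) max_r. Qed.

Lemma clamp_itv t : 0 <= clamp t <= 1.
Proof. by rewrite /clamp le_max lexx/= ge_max ler01 ge_min lexx orbT. Qed.

Lemma continuous_clamp (X : topologicalType) (f : X -> R) :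
  continuous f -> continuous (fun x => clamp (f x)).
Proof. by move=> cf; exact: (continuousT_comp cf clamp_continuous). Qed.

End Continuity.

(* Dispatches on the head symbol of the body: trying the lemmas in turn is slow,
   because a failing unification unfolds the arithmetic operations. *)
Ltac cts := lazymatch goal with
  | H : (forall x, @continuous_at _ _ x ?g) |- forall x, @continuous_at _ _ x ?g => exact H
  | |- forall x, @continuous_at _ _ x (fun t => t) => exact: continuous_id
  | |- forall x, @continuous_at _ _ x (fun t => (_, _)) => apply: continuous_pair; cts
  | |- forall x, @continuous_at _ _ x (fun t => fst _) => apply: continuous_fst2; cts
  | |- forall x, @continuous_at _ _ x (fun t => snd _) => apply: continuous_snd2; cts
  | |- forall x, @continuous_at _ _ x (fun t => clamp _) => apply: continuous_clamp; cts
  | |- forall x, @continuous_at _ _ x (fun t => _ - _) => apply: continuous_sub2; cts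
  | |- forall x, @continuous_at _ _ x (fun t => _ + _) => apply: continuous_add2; cts
  | |- forall x, @continuous_at _ _ x (fun t => - _) => apply: continuous_opp1; cts
  | |- forall x, @continuous_at _ _ x (fun t => _ * _) => apply: continuous_mul2; cts
  | |- forall x, @continuous_at _ _ x (fun t => _ ^+ 2) => apply: continuous_mul2; cts
  | |- forall x, @continuous_at _ _ x (fun t => Num.max _ _) => apply: continuous_max2; cts
  | |- forall x, @continuous_at _ _ x (fun t => Num.min _ _) => apply: continuous_min2; cts
  | H : (forall x, @continuous_at ?A ?B x ?g) |- forall x, @continuous_at ?X ?Y x (fun t => ?g (@?f t)) =>
    let cf := fresh in
    have cf : continuous (f : X -> A); [cbv beta; cts|exact (continuousT_comp cf H)]
  | |- forall x, @continuous_at _ _ x (GRing.mul ?a) =>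
    apply: (@continuous_mul2 _ _ (fun=> a) (fun t => t)); cts
  | |- forall x, @continuous_at _ _ x (GRing.add ?a) =>
    apply: (@continuous_add2 _ _ (fun=> a) (fun t => t)); cts
  | |- forall x, @continuous_at _ _ x (@clamp _) => exact: clamp_continuous
  | |- forall x, @continuous_at _ _ x (@fst _ _) => exact: continuous_fst
  | |- forall x, @continuous_at _ _ x (@snd _ _) => exact: continuous_snd
  | |- _ => exact: continuous_const
  end.

(** * Paths in the plane *)

Section Plane.
Context (R : realType).
Notation P := (R * R)%type.
Implicit Types (z w : P) (O D K : set P).

(* Paths are constant outside [0, 1], so that concatenating [g] and [h] at [y]
   amounts to the sum [g (2 t) + h (2 t - 1) - y], without any gluing. *)
Definition pconn O z w := exists g : R -> P,
  [/\ continuous g, forall t, t <= 0 -> g t = z, forall t, 1 <= t -> g t = w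
    & forall t, O (g t)].

Lemma pconn_refl O z : O z -> pconn O z z.
Proof. by move=> Oz; exists (fun=> z); split=> //; exact: continuous_const. Qed.

Lemma pconn_l O z w : pconn O z w -> O z.
Proof. by move=> [g [_ g0 _ gO]]; rewrite -(g0 0)//. Qed.

Lemma pconn_r O z w : pconn O z w -> O w.
Proof. by move=> [g [_ _ g1 gO]]; rewrite -(g1 1)//. Qed.

Lemma pconn_sym O z w : pconn O z w -> pconn O w z.
Proof.
move=> [g [cg g0 g1 gO]]; exists (fun t => g (1 - t)); split => //.
- by cts.
- by move=> t t0; rewrite g1//; lra.
- by move=> t t0; rewrite g0//; lra.
Qed.

Lemma pconn_trans O x y z : pconn O x y -> pconn O y z -> pconn O x z.
Proof.
move=> [g [cg g0 g1 gO]] [h [ch h0 h1 hO]].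
pose k t := ((g (2 * t)).1 + (h (2 * t - 1)).1 - y.1,
             (g (2 * t)).2 + (h (2 * t - 1)).2 - y.2).
have kE t : k t = if t <= 2^-1 then g (2 * t) else h (2 * t - 1).
  case: ifPn => [tle|]; last rewrite -ltNge => tgt.
    rewrite /k h0; last by lra.
    by case: (g _) => a b /=; congr pair; ring.
  rewrite /k g1; last by lra.
  by case: (h _) => a b /=; congr pair; ring.
exists k; split.
- by rewrite /k; cts.
- move=> t t0; rewrite kE ifT; first by rewrite g0//; lra.
  by lra.
- move=> t t1; rewrite kE ifF; last by apply/negbTE; rewrite -ltNge; lra.
  by rewrite h1//; lra.
- by move=> t; rewrite kE; case: ifP.
Qed.

Lemma pconnW O O' z w : O `<=` O' -> pconn O z w -> pconn O' z w.
Proof. by move=> OO' [g [? ? ? gO]]; exists g; split=> // t; exact: OO'. Qed.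

Lemma pconn_map O O' (h : P -> P) z w : continuous h ->
  (forall y, O y -> O' (h y)) -> pconn O z w -> pconn O' (h z) (h w).
Proof.
move=> ch hO [g [cg g0 g1 gO]]; exists (fun t => h (g t)); split.
- by cts.
- by move=> t t0; rewrite g0.
- by move=> t t0; rewrite g1.
- by move=> t; exact/hO.
Qed.

(** The initial pieces of a path join its origin to all its points. Hence any property that is
    constant on path components of [O] holds along the whole path, which allows such a path to be
    reused in a smaller or different set. *)
Lemma pconn_self O z w : pconn O z w -> pconn (pconn O z) z w.
Proof.
move=> [g [cg g0 g1 gO]]; exists g; split => // t.
exists (fun s => g (clamp s * t)); split.
- by cts.
- by move=> s /clamp_le0 ->; rewrite mul0r g0.
- by move=> s /clamp_ge1 ->; rewrite mul1r.
- by move=> s.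
Qed.

Definition seg z w (t : R) : P :=
  (z.1 + clamp t * (w.1 - z.1), z.2 + clamp t * (w.2 - z.2)).

Lemma seg_continuous z w : continuous (seg z w).
Proof.
by rewrite /seg; cts.
Qed.

Lemma seg0 z w t : t <= 0 -> seg z w t = z.
Proof. by move=> t0; rewrite /seg clamp_le0// !mul0r !addr0; case: z. Qed.

Lemma seg1 z w t : 1 <= t -> seg z w t = w.
Proof.
move=> t0; rewrite /seg clamp_ge1// !mul1r !(addrC _ (_ - _)) !subrK.
by case: w.
Qed.

Lemma pconn_seg O z w : (forall t, 0 <= t <= 1 -> O (seg z w t)) -> pconn O z w.
Proof.
move=> segO; exists (seg z w); split.
- exact: seg_continuous.
- by move=> t; exact: seg0.
- by move=> t; exact: seg1.
- move=> t; suff -> : seg z w t = seg z w (clamp t) by apply/segO/clamp_itv.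
  by rewrite {2}/seg clamp_id// clamp_itv.
Qed.

Lemma pconnT z w : pconn setT z w.
Proof. exact: pconn_seg. Qed.

Lemma nbhs_square z O : nbhs z O <-> exists2 e : R, 0 < e &
  forall w, `|w.1 - z.1| < e -> `|w.2 - z.2| < e -> O w.
Proof.
split=> [/nbhs_ballP[e /= e0 eO]|[e e0 eO]].
  exists e => // w w1 w2; apply: eO.
  by split; rewrite /ball /= distrC.
apply/nbhs_ballP; exists e => // w [] /=.
by rewrite /ball/= => w1 w2; apply: eO; rewrite distrC.
Qed.

Lemma seg_near z w t (e : R) : 0 < e ->
  `|w.1 - z.1| < e -> `|w.2 - z.2| < e ->
  `|(seg z w t).1 - z.1| < e /\ `|(seg z w t).2 - z.2| < e.
Proof.
move=> e0 w1 w2; rewrite /seg/=.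
have /andP[c0 c1] := clamp_itv t.
rewrite !(addrAC _ _ (- _)) !subrr !add0r !normrM (ger0_norm c0).
by split; apply: le_lt_trans (ler_piMl _ c1) _.
Qed.

Lemma open_pconn O z : open O -> open (pconn O z).
Proof.
move=> oO; rewrite openE => w zw.
have /nbhs_square[e e0 eO] : nbhs w O by apply: open_nbhs_nbhs; split=> //; exact: pconn_r zw.
apply/nbhs_square; exists e => // w' w1 w2.
apply: (pconn_trans zw); apply: pconn_seg => t _.
by have [] := seg_near t e0 w1 w2; exact: eO.
Qed.

(** [K] itself may contain no path. The component of [x] in [O] and the union of the other
    components are both open, because small squares are joined to their centre by segments, so [K]
    lies in a single component. *)
Lemma connected_pconn O K x y : open O -> connected K -> K `<=` O ->
  K x -> K y -> pconn O x y.
Proof.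
move=> oO cK KO Kx Ky.
have : K `&` pconn O x = K; last by move=> KE; move: Ky; rewrite -KE => -[].
apply: cK.
- by exists x; split=> //; apply: pconn_refl; exact: KO.
- by exists (pconn O x) => //; exact: open_pconn.
- exists (~` [set y | O y /\ ~ pconn O x y]).
    rewrite closedC openE => w [Ow xw].
    have := @open_pconn O w oO; rewrite openE => /(_ w (pconn_refl Ow)).
    apply: filterS => v wv; split; first exact: pconn_r wv.
    by move=> xv; apply: xw; apply: pconn_trans xv _; exact: pconn_sym.
  apply/seteqP; split=> w [Kw]; first by move=> xw; split=> // -[].
  by move=> h; split => //; apply: contrapT => xw; apply: h; split=> //; exact: KO.
Qed.


End Plane.

(** * Lifting maps defined on the plane *)

Lemma glue_continuous (R : realType) (X E : topologicalType) (phi : X -> R) (m : R)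
    (g1 g2 : X -> E) : continuous phi -> continuous g1 -> continuous g2 ->
  (forall x, phi x = m -> g1 x = g2 x) ->
  continuous (fun x => if phi x <= m then g1 x else g2 x).
Proof.
move=> cphi c1 c2 g12; apply/continuous_closedP => A cA.
have -> : (fun x => if phi x <= m then g1 x else g2 x) @^-1` A =
    (phi @^-1` [set t | t <= m] `&` g1 @^-1` A) `|`
    (phi @^-1` [set t | m <= t] `&` g2 @^-1` A).
  apply/seteqP; split=> x /=.
    by case: ifPn => [|]; [left|rewrite -ltNge => /ltW; right].
  case=> -[xm Ax]; first by rewrite xm.
  case: ifPn => // xm'; rewrite g12//; apply/eqP.
  by rewrite eq_le xm xm'.
have pc (Z : topologicalType) (h : X -> Z) D : continuous h -> closed D -> closed (h @^-1` D).
  by move=> /continuous_closedP; apply.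
by apply: closedU; apply: closedI; apply: pc => //; apply: closed_le || apply: closed_ge.
Qed.

Section CoveringLike.
Context (E B : topologicalType) (p : E -> B).

(* These two properties are all that lifting requires of [p]; they hold for
   covering maps and for the exponential [eR] below. *)
Definition local_sections := forall y : B, exists U, [/\ open U, U y &
  forall e0, U (p e0) -> exists s : B -> E,
    [/\ s (p e0) = e0, forall u, U u -> p (s u) = u & forall u, U u -> {for u, continuous s}]].

Definition locally_injective := forall e0, exists V,
  [/\ open V, V e0 & forall e1 e2, V e1 -> V e2 -> p e1 = p e2 -> e1 = e2].

(** The set where [g1] and [g2] agree is open in [K] by local injectivity, and closed because [E] is
    Hausdorff. *)
Lemma lift_unique (X : topologicalType) (K : set X) (g1 g2 : X -> E) x0 :
  hausdorff_space E -> locally_injective -> connected K ->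
  continuous g1 -> continuous g2 -> (forall x, K x -> p (g1 x) = p (g2 x)) ->
  K x0 -> g1 x0 = g2 x0 -> forall x, K x -> g1 x = g2 x.
Proof.
rewrite open_hausdorff => hE linj cK c1 c2 pg Kx0 g0.
have KE : K `&` [set x | g1 x = g2 x] = K.
  apply: cK; first by exists x0.
  - exists [set x | exists V, [/\ open V, V (g1 x), V (g2 x) &
        forall e1 e2, V e1 -> V e2 -> p e1 = p e2 -> e1 = e2]].
      rewrite openE => x [V [oV V1 V2 Vi]].
      have : nbhs x (g1 @^-1` V `&` g2 @^-1` V).
        by apply: filterI; [apply: c1|apply: c2]; apply: open_nbhs_nbhs.
      by apply: filterS => y [? ?]; exists V.
    apply/seteqP; split => x [Kx /=].
      move=> g12; split=> //=; have [V [oV Vx Vi]] := linj (g1 x).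
      by exists V; split=> //; rewrite -g12.
    by case=> V [_ V1 V2 Vi]; split=> //; apply: Vi => //; exact: pg.
  - exists [set x | g1 x = g2 x] => //.
    rewrite -[X in closed X]setCK closedC openE => x /= /eqP /hE.
    move=> [[A1 A2]/= [/set_mem xA1 /set_mem xA2] [oA1 oA2 /eqP A12]].
    have : nbhs x (g1 @^-1` A1 `&` g2 @^-1` A2).
      by apply: filterI; [apply: c1|apply: c2]; apply: open_nbhs_nbhs.
    apply: filterS => y [/= A1y A2y] g12.
    have : (A1 `&` A2 : set E) (g1 y) by split=> //; rewrite g12.
    by rewrite A12.
by move=> x; rewrite -KE => -[].
Qed.

End CoveringLike.

Lemma connectedT (R : realType) : connected [set: R].
Proof. by apply/connected_intervalP => x y _ _ z. Qed.

Lemma pconn_connected (R : realType) (K : set (R * R)) x0 :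
  (forall y, K y -> pconn K x0 y) -> connected K.
Proof.
move=> xK; have [[y0 Ky0]|K0] := pselect (exists y, K y); last first.
  have -> : K = set0 by rewrite -subset0 => y Ky; apply: K0; exists y.
  exact: connected0.
have -> : K = \bigcup_(y in K) [set w | exists g : R -> R * R,
    [/\ continuous g, g 0 = x0, g 1 = y, (forall t, K (g t)) & exists t, w = g t]].
  apply/seteqP; split=> w.
    move=> Kw; have [g [cg g0 g1 gK]] := xK _ Kw.
    by exists w => //; exists g; split => //; [exact: g0|exact: g1|exists 1; rewrite g1].
  by move=> [y Ky [g [_ _ _ gK [t ->]]]].
apply: bigcup_connected.
  exists x0 => y Ky; have [g [cg g0 g1 gK]] := xK _ Ky.
  by exists g; split => //; [exact: g0|exact: g1|exists 0; rewrite g0].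
move=> y Ky.
pose I := [set g : R -> R * R |
    [/\ continuous g, g 0 = x0, g 1 = y & forall t, K (g t)]].
rewrite (_ : mkset _ = \bigcup_(g in I) (g @` setT)); last first.
  apply/seteqP; split=> w [g].
    by move=> [? ? ? ? [t ->]]; exists g => //; exists t.
  by move=> [? ? ? ?] [t _ <-]; exists g; split=> //; exists t.
apply: bigcup_connected; first by exists x0 => g [_ g0 _ _]; exists 0.
move=> g [cg _ _ _]; apply: connected_continuous_connected; first exact: connectedT.
exact: continuous_subspaceT.
Qed.

Section LiftPlane.
Context (R : realType) (E B : topologicalType) (p : E -> B).
Notation P := (R * R)%type.
Hypotheses (hE : hausdorff_space E) (ls : local_sections p) (li : locally_injective p).

(** The starting point is arbitrary: a lift built on one side of a line can then be continued on the
    other side from the value it takes at a point of the line. *)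
Definition liftable (q : P -> B) := forall z0 e0, p e0 = q z0 ->
  exists g : P -> E, [/\ continuous g, g z0 = e0 & forall z, p (g z) = q z].

(** The side containing [z0] is lifted first, and its value at [x0] starts the lift of the other
    side. Both lifts agree on the whole level set, which is connected. *)
Lemma liftable_glue (phi : P -> R) m (q q1 q2 : P -> B) x0 :
  continuous phi -> connected [set z | phi z = m] -> phi x0 = m ->
  (forall z, phi z <= m -> q1 z = q z) -> (forall z, m <= phi z -> q2 z = q z) ->
  liftable q1 -> liftable q2 -> liftable q.
Proof.
move=> cphi cline x0m qE1 qE2 L1 L2 z0 e0 e0z0.
suff [g1 [g2 [c1 c2 p1 p2 [g12 gz0]]]] : exists g1 g2 : P -> E,
    [/\ continuous g1, continuous g2, forall z, p (g1 z) = q1 z,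
        forall z, p (g2 z) = q2 z & g1 x0 = g2 x0 /\
        (if phi z0 <= m then g1 z0 else g2 z0) = e0].
  exists (fun z => if phi z <= m then g1 z else g2 z); split => //.
    apply: glue_continuous => //.
    apply: (lift_unique hE li cline c1 c2 _ x0m g12) => x /= xm.
    by rewrite p1 p2 qE1 ?xm// qE2 ?xm.
  move=> z; case: ifPn => [zm|]; first by rewrite p1 qE1.
  by rewrite -ltNge => /ltW zm; rewrite p2 qE2.
have [zm|zm] := leP (phi z0) m.
- have [g1 [c1 g1z p1]] := L1 z0 e0 (etrans e0z0 (esym (qE1 _ zm))).
  have [|g2 [c2 g2x p2]] := L2 x0 (g1 x0); first by rewrite p1 qE1 ?qE2 ?x0m.
  by exists g1, g2.
- have [g2 [c2 g2z p2]] := L2 z0 e0 (etrans e0z0 (esym (qE2 _ (ltW zm)))).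
  have [|g1 [c1 g1x p1]] := L1 x0 (g2 x0); first by rewrite p2 qE1 ?qE2 ?x0m.
  by exists g1, g2.
Qed.

Definition rect x y s (z : P) : P :=
  (Num.max x (Num.min z.1 (x + s)), Num.max y (Num.min z.2 (y + s))).

Lemma rect_continuous x y s : continuous (rect x y s).
Proof. by rewrite /rect; cts. Qed.

Lemma connected_vline m : connected [set z : P | z.1 = m].
Proof.
apply: (@pconn_connected _ _ (m, 0)) => y /= ym; apply: pconn_seg => t _ /=.
by rewrite ym; ring.
Qed.

Lemma connected_hline m : connected [set z : P | z.2 = m].
Proof.
apply: (@pconn_connected _ _ (0, m)) => y /= ym; apply: pconn_seg => t _ /=.
by rewrite ym; ring.
Qed.

Lemma clampI_half (a s t : R) : 0 <= s ->
  (t <= a + s / 2 -> Num.max a (Num.min t (a + s / 2)) = Num.max a (Num.min t (a + s))) /\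
  (a + s / 2 <= t -> Num.max (a + s / 2) (Num.min t (a + s / 2 + s / 2))
      = Num.max a (Num.min t (a + s))).
Proof.
move=> s0; split=> t1; first by rewrite !min_l//; lra.
have -> : a + s / 2 + s / 2 = a + s by lra.
by rewrite !max_r// le_min; apply/andP; split; lra.
Qed.

Lemma liftable_quarter q x y s : 0 <= s ->
  (forall i j : bool, liftable (fun z => q (rect (x + s / 2 *+ i) (y + s / 2 *+ j) (s / 2) z))) ->
  liftable (fun z => q (rect x y s z)).
Proof.
move=> s0 L4.
pose h i z := q (Num.max (x + s / 2 *+ i) (Num.min z.1 (x + s / 2 *+ i + s / 2)),
   Num.max y (Num.min z.2 (y + s))).
have Lh (i : bool) : liftable (h i).
  apply: (@liftable_glue snd (y + s / 2) _ _ _ (0, y + s / 2) _ _ _ _ _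
     (L4 i false) (L4 i true)) => //.
  - by cts.
  - exact: connected_hline.
  - by move=> z zm; rewrite /h /rect !mulr0n !addr0 (clampI_half y z.2 s0).1.
  - by move=> z zm; rewrite /h /rect !mulr1n (clampI_half y z.2 s0).2.
apply: (@liftable_glue fst (x + s / 2) _ _ _ (x + s / 2, 0) _ _ _ _ _
     (Lh false) (Lh true)) => //.
- by cts.
- exact: connected_vline.
- by move=> z zm; rewrite /h /rect !mulr0n !addr0 (clampI_half x z.1 s0).1.
- by move=> z zm; rewrite /h /rect !mulr1n (clampI_half x z.1 s0).2.
Qed.

Lemma liftable_small q (U : set B) : continuous q -> (forall z, U (q z)) ->
  (forall e0, U (p e0) -> exists s : B -> E,
    [/\ s (p e0) = e0, forall u, U u -> p (s u) = u & forall u, U u -> {for u, continuous s}]) ->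
  liftable q.
Proof.
move=> cq Uq Us z0 e0 e0z0.
have [|s [s0 ps cs]] := Us e0; first by rewrite e0z0.
exists (s \o q); split => /=.
- by move=> z; apply: continuous_comp; [exact: cq|exact: cs].
- by rewrite -e0z0.
- by move=> z; rewrite ps.
Qed.

(* By compactness some subdivision consists of squares mapped into trivialized
   open sets; four adjacent squares then merge into one. *)
Lemma liftable_square q x0 y0 s : continuous q -> 0 <= s ->
  liftable (fun z => q (rect x0 y0 s z)).
Proof.
move=> cq s0.
pose sd n : R := s / 2 ^+ n.
have sd0 n : 0 <= sd n by rewrite divr_ge0// exprn_ge0.
have sdS n : sd n / 2 = sd n.+1.
  by rewrite /sd exprSr invfM mulrA.
pose Q n (z : P) := forall x y, x <= z.1 <= x + sd n -> y <= z.2 <= y + sd n ->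
  liftable (fun w => q (rect x y (sd n) w)).
pose K : set P := `[x0, x0 + s]%classic `*` `[y0, y0 + s]%classic.
(* Compactness plays the role of a Lebesgue number: one [n] serves all points of the square at
   once. *)
have : near_covering K.
  by apply/compact_near_coveringP; apply: compact_setX; exact: segment_compact.
move=> /(_ _ (@nbhs nat _ \oo) Q _) [].
  move=> z Kz; have [U [oU Uz Us]] := ls (q z).
  have /nbhs_square[e e0 eU] : nbhs z (q @^-1` U) by apply: cq; exact: open_nbhs_nbhs.
  (* The bound makes the side [s / 2 ^ n] smaller than [e / 2]; a small square containing a point
     within [e / 2] of [z] then stays within [e] of [z]. The denominator is [s + 1] because [s] may
     vanish. *)
  have e20 : 0 < e / 2 / (s + 1) by rewrite !divr_gt0// ltr_pwDr.
  have := @near_infty_natSinv_expn_lt R (PosNum e20); rewrite /= => nearn.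
  exists ([set w | `|w.1 - z.1| < e / 2 /\ `|w.2 - z.2| < e / 2],
    [set n | 1 / 2 ^+ n < e / 2 / (s + 1)]) => /=.
    split=> //; apply/nbhs_square; exists (e / 2) => //; by rewrite divr_gt0.
  move=> [w n] /= [[w1 w2] sn] x y xw yw.
  have sde : sd n < e / 2.
    rewrite /sd; apply: le_lt_trans (_ : (s + 1) * (1 / 2 ^+ n) < _).
      by rewrite div1r ler_wpM2r ?invr_ge0 ?exprn_ge0// lerDl.
    by rewrite mulrC -ltr_pdivlMr// ltr_pwDr.
  apply: (@liftable_small _ U) => //.
    exact: (continuousT_comp (@rect_continuous x y (sd n)) cq).
  move=> v; apply: eU; rewrite /rect/=; have sdn := sd0 n.
    have : x <= Num.max x (Num.min v.1 (x + sd n)) <= x + sd n.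
      by rewrite le_max lexx/= ge_max ge_min lexx orbT andbT lerDl.
    by move: xw w1 => /andP[? ?]; rewrite !ltr_norml => /andP[? ?] /andP[? ?]; apply/andP; split; lra.
  have : y <= Num.max y (Num.min v.2 (y + sd n)) <= y + sd n.
    by rewrite le_max lexx/= ge_max ge_min lexx orbT andbT lerDl.
  by move: yw w2 => /andP[? ?]; rewrite !ltr_norml => /andP[? ?] /andP[? ?]; apply/andP; split; lra.
move=> n _ /(_ n (leqnn n)) KQ.
(* Induction from the finest squares, [m = 0], up to the whole square, [m = n]. *)
suff H m : (m <= n)%N -> forall x y, x0 <= x -> x + sd (n - m)%N <= x0 + s ->
    y0 <= y -> y + sd (n - m)%N <= y0 + s ->
    liftable (fun w => q (rect x y (sd (n - m)%N) w)).
  have := H n (leqnn n) x0 y0; rewrite subnn /sd expr0 divr1; exact.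
elim: m => [_|m IH mn] x y; rewrite ?subn0 => x1 x2 y1 y2.
  have sdn := sd0 n.
  by apply: (KQ (x, y)) => /=; [split; rewrite /= in_itv/=|..]; apply/andP; split; lra.
apply: liftable_quarter => // i j; rewrite sdS.
have -> : (n - m.+1).+1 = (n - m)%N by lia.
have sdm := sd0 (n - m)%N.
have sd2 : sd (n - m.+1)%N = sd (n - m)%N *+ 2.
  have -> : (n - m)%N = (n - m.+1).+1 by lia.
  by rewrite -sdS mulr2n; lra.
rewrite sd2 in x2 y2; set e := sd (n - m)%N in sdm x2 y2 *.
have half (t0 t : R) (b : bool) : t0 <= t -> t + e *+ 2 <= t0 + s ->
    t0 <= t + e *+ b /\ t + e *+ b + e <= t0 + s.
  by clear -sdm; rewrite mulr2n; case: b; rewrite ?mulr1n ?mulr0n; split; lra.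
have [i1 i2] := half _ _ i x1 x2; have [j1 j2] := half _ _ j y1 y2.
by apply: IH => //; exact: ltnW.
Qed.

(** The plane is exhausted by the squares [K n]. Their lifts agree where both are defined, by
    uniqueness on a connected square, so each point may use any large enough square. *)
Theorem lift_plane q : continuous q -> liftable q.
Proof.
move=> cq z0 e0 e0z0.
pose N0 := (Num.bound `|z0.1| + Num.bound `|z0.2|)%N.
pose K (n : nat) := [set z : P | `|z.1| <= n%:R /\ `|z.2| <= n%:R].
have rK n z : K n z -> rect (- n%:R) (- n%:R) (n%:R *+ 2) z = z.
  case: z => a b [/=]; rewrite !ler_norml => /andP[? ?] /andP[? ?].
  by rewrite /rect/= mulr2n !addKr !min_l// !max_r.
have Kz0 n : (N0 <= n)%N -> K n z0.
  move=> Nn; have b1 := archi_boundP (normr_ge0 z0.1).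
  have b2 := archi_boundP (normr_ge0 z0.2).
  have c1 : ((Num.bound `|z0.1|)%:R : R) <= n%:R by rewrite ler_nat; apply: leq_trans Nn; rewrite leq_addr.
  have c2 : ((Num.bound `|z0.2|)%:R : R) <= n%:R by rewrite ler_nat; apply: leq_trans Nn; rewrite leq_addl.
  by split; [apply: le_trans c1|apply: le_trans c2]; exact: ltW.
have /choice[G HG] : forall n, exists g : P -> E, (N0 <= n)%N ->
    [/\ continuous g, g z0 = e0 & forall z, K n z -> p (g z) = q z].
  move=> n; have [Nn|] := leqP N0 n; last by exists (fun=> e0).
  have n20 : 0 <= (n%:R *+ 2 : R) by rewrite mulrn_wge0.
  have [|g [cg g0 pg]] := @liftable_square q (- n%:R) (- n%:R) _ cq n20 z0 e0.
    by rewrite rK//; exact: Kz0.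
  by exists g => _; split=> // z Kz; rewrite pg rK.
have GG n m z : (N0 <= n)%N -> (N0 <= m)%N -> K n z -> K m z -> G n z = G m z.
  wlog nm : n m / (n <= m)%N => [H|].
    by have [/H|/ltnW mn ? ? ? ?] := leqP n m; [|rewrite -(H m n)].
  move=> Nn Nm Kn _; have [cn gn pn] := HG n Nn; have [cm gm pm] := HG m Nm.
  have cK : connected (K n).
    apply: (@pconn_connected _ _ (0, 0)) => y [y1 y2]; apply: pconn_seg => t /andP[t0 t1].
    split; rewrite /seg/= !add0r subr0 normrM clamp_id ?t0// ger0_norm//;
      by apply: le_trans (ler_piMl _ t1) _.
  apply: (lift_unique hE li cK cn cm _ (Kz0 n Nn)) => //; last by rewrite gn gm.
  move=> x Kx; rewrite pn// pm//; case: Kx => ? ?.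
  by split; apply: le_trans (_ : n%:R <= _) => //; rewrite ler_nat.
(* The margin 1 makes the square chosen for [z] contain a neighbourhood of [z], so that near [z] the
   global lift coincides with one continuous lift. *)
pose ind (z : P) := (N0 + Num.bound (`|z.1| + 1) + Num.bound (`|z.2| + 1))%N.
have Kind z w : `|w.1 - z.1| < 1 -> `|w.2 - z.2| < 1 -> K (ind z) w.
  move=> w1 w2.
  have b1 : `|z.1| + 1 < (Num.bound (`|z.1| + 1))%:R by apply: archi_boundP; rewrite addr_ge0.
  have b2 : `|z.2| + 1 < (Num.bound (`|z.2| + 1))%:R by apply: archi_boundP; rewrite addr_ge0.
  have c1 : ((Num.bound (`|z.1| + 1))%:R : R) <= (ind z)%:R by rewrite ler_nat /ind -addnA addnCA leq_addr.
  have c2 : ((Num.bound (`|z.2| + 1))%:R : R) <= (ind z)%:R by rewrite ler_nat /ind leq_addl.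
  split.
    by have := ler_normD (w.1 - z.1) z.1; rewrite subrK => ?; lra.
  by have := ler_normD (w.2 - z.2) z.2; rewrite subrK => ?; lra.
have Kindz z : K (ind z) z by apply: Kind; rewrite subrr normr0.
have Nind z : (N0 <= ind z)%N by rewrite /ind -addnA leq_addr.
exists (fun z => G (ind z) z); split.
- move=> z.
  have [cz _ _] := HG (ind z) (Nind z).
  apply: cvg_trans (cz z); apply: near_eq_cvg; apply/nbhs_square; exists 1 => // w w1 w2.
  by apply: GG => //; exact: Kind.
- by have [] := HG (ind z0) (Nind z0).
- by move=> z; have [_ _ pz] := HG (ind z) (Nind z); rewrite pz.
Qed.

End LiftPlane.

(** * The exponential map of the circle *)

Section Circle.
Context (R : realType).
Notation P := (R * R)%type.

Lemma Re_continuous : continuous (fun z : (R[i])^o => complex.Re z : R).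
Proof.
move=> z; apply/(@cvgrPdist_lt _ _ _ _ (@nbhs_filter (R[i])^o z)) => e e0.
apply/nbhs_ballP; exists (e%:C)%C; first by rewrite /= ltcR.
move=> w; rewrite /ball/= => zw; rewrite -ltcR; apply: le_lt_trans zw.
by have := normc_ge_Re (z - w); case: z => ? ?; case: w.
Qed.

Lemma Im_continuous : continuous (fun z : (R[i])^o => complex.Im z : R).
Proof.
move=> z; apply/(@cvgrPdist_lt _ _ _ _ (@nbhs_filter (R[i])^o z)) => e e0.
apply/nbhs_ballP; exists (e%:C)%C; first by rewrite /= ltcR.
move=> w; rewrite /ball/= => zw; rewrite -ltcR; apply: le_lt_trans zw.
rewrite normc_def lecR -sqrtr_sqr ler_wsqrtr//.
by case: z => ? ?; case: w => ? ? /=; rewrite lerDr sqr_ge0.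
Qed.

Lemma Complex_continuous (X : topologicalType) (f g : X -> R) :
  continuous f -> continuous g -> continuous (fun x => (f x +i* g x)%C : (R[i])^o).
Proof.
move=> cf cg x; apply/cvgrPdist_lt => -[e e'] /=; rewrite ltcE/= => /andP[/eqP -> {e'} e0].
have e20 : 0 < e / 2 by rewrite divr_gt0.
have /cvgrPdist_lt /(_ _ e20) fx := cf x.
have /cvgrPdist_lt /(_ _ e20) gx := cg x.
apply: filterS2 fx gx => y fy gy.
rewrite normc_def (_ : (_ +i* 0)%C = (e%:C)%C)// ltcR /=.
rewrite -(ger0_norm (ltW e0)) -sqrtr_sqr ltr_sqrt ?exprn_gt0//.
rewrite -real_normK ?num_real// -[X in _ + X]real_normK ?num_real//.
have : `|f x - f y| ^+ 2 <= (e / 2) ^+ 2 by rewrite lerXn2r ?nnegrE// ltW.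
have : `|g x - g y| ^+ 2 <= (e / 2) ^+ 2 by rewrite lerXn2r ?nnegrE// ltW.
have : 0 < e ^+ 2 by rewrite exprn_gt0.
by rewrite expr_div_n; lra.
Qed.

Definition cX (z : circle R) : R := complex.Re (\val z : R[i]).
Definition cY (z : circle R) : R := complex.Im (\val z : R[i]).

Lemma circle_valE (z : circle R) : (\val z : R[i]) = (cX z +i* cY z)%C.
Proof. by rewrite /cX /cY; case: (\val z). Qed.

Lemma circle_inj (z w : circle R) : cX z = cX w -> cY z = cY w -> z = w.
Proof.
by move=> zX zY; apply: val_inj; rewrite /= (circle_valE z) (circle_valE w) zX zY.
Qed.

Lemma circle_norm (z : circle R) : cX z ^+ 2 + cY z ^+ 2 = 1.
Proof.
have /set_mem := valP z; rewrite /unit_circle/= normc_def => -[].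
move=> h; rewrite -[LHS]sqr_sqrtr ?addr_ge0 ?sqr_ge0//.
by rewrite [Num.sqrt _]h expr1n.
Qed.

Lemma circ_subproof (x y : R) : x ^+ 2 + y ^+ 2 = 1 ->
  ((x +i* y)%C : (R[i])^o) \in @unit_circle R.
Proof. by move=> xy; apply/mem_set; rewrite /unit_circle/= normc_def /= xy sqrtr1. Qed.

Definition circ (x y : R) (h : x ^+ 2 + y ^+ 2 = 1) : circle R :=
  exist _ ((x +i* y)%C : (R[i])^o) (circ_subproof h).

Lemma cX_continuous : continuous cX.
Proof.
have h : continuous (fun z : circle R => \val z : (R[i])^o) by exact: initial_continuous.
exact: (continuousT_comp h Re_continuous).
Qed.

Lemma cY_continuous : continuous cY.
Proof.
have h : continuous (fun z : circle R => \val z : (R[i])^o) by exact: initial_continuous.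
exact: (continuousT_comp h Im_continuous).
Qed.

Lemma circle_continuous (X : topologicalType) (f : X -> circle R) :
  continuous (fun x => cX (f x)) -> continuous (fun x => cY (f x)) -> continuous f.
Proof.
move=> fX fY; apply: continuous_comp_initial.
rewrite (_ : _ \o _ = fun x => (cX (f x) +i* cY (f x))%C : (R[i])^o).
  exact: Complex_continuous.
by apply/funext => x /=; rewrite -circle_valE.
Qed.

Definition tau : R := pi *+ 2.

Lemma tau_gt0 : 0 < tau. Proof. by rewrite /tau mulrn_wgt0// pi_gt0. Qed.

Definition eR (b : R) : circle R := circ (cos2Dsin2 (tau * b)).

Lemma cX_eR b : cX (eR b) = cos (tau * b). Proof. by []. Qed.
Lemma cY_eR b : cY (eR b) = sin (tau * b). Proof. by []. Qed.

Lemma eR_continuous : continuous eR.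
Proof.
have h : continuous (fun b : R => tau * b) by cts.
apply: circle_continuous.
  exact: (continuousT_comp h (@continuous_cos R)).
exact: (continuousT_comp h (@continuous_sin R)).
Qed.

Lemma eR_int b (k : int) : eR (b + k%:~R) = eR b.
Proof.
have nat_case c (n : nat) : eR (c + n%:R) = eR c.
  apply: circle_inj; rewrite ?cX_eR ?cY_eR mulrDr mulr_natr.
    by rewrite (periodicn (@cosD2pi R)).
  by rewrite (periodicn (@sinD2pi R)).
case: k => n; first exact: nat_case.
by rewrite NegzE -(nat_case (b + _) n.+1) mulrNz subrK.
Qed.

Lemma eR0_int t : eR t = eR 0 -> exists k : int, t = k%:~R.
Proof.
move=> t0; pose v := t - (Num.floor t)%:~R.
have v01 : 0 <= v < 1.
  rewrite /v subr_ge0 floor_le/= ltrBlDl.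
  by have := floorD1_gt t; rewrite intrD.
have cv : cos (tau * v) = 1.
  rewrite -cX_eR /v -[- _%:~R]mulrNz eR_int t0 cX_eR mulr0 cos0//.
have p0 := pi_gt0 R; exists (Num.floor t); apply/eqP; rewrite -subr_eq0; apply/eqP.
move: v01 => /andP[v0 v1].
(* Cosine is injective on half a turn only, so the second half is reflected through
   [tau - tau * v]. *)
have [v2|v2] := leP v (2^-1).
  have : tau * v = 0.
    apply: (@cos_inj R); rewrite ?in_itv/= ?cos0//.
      by rewrite mulr_ge0// ?(ltW tau_gt0)//= /tau mulr2n; nra.
    by rewrite lexx ltW.
  by move/eqP; rewrite mulf_eq0 (gt_eqF tau_gt0)/= => /eqP.
have : tau - tau * v = 0.
  apply: (@cos_inj R); rewrite ?in_itv/= ?cos0 ?lexx ?(ltW p0)//.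
    by apply/andP; split; rewrite /tau mulr2n; nra.
  by rewrite -[RHS]cv -[RHS]cosN /tau addrC cosD2pi.
by rewrite /tau mulr2n; nra.
Qed.

Lemma eR_eq b b' : eR b = eR b' -> exists k : int, b' = b + k%:~R.
Proof.
move=> bb'; suff [k bk] : exists k : int, b' - b = k%:~R by exists k; rewrite -bk; ring.
apply: eR0_int; move: bb' => /[dup] /(congr1 cX) + /(congr1 cY).
rewrite !cX_eR !cY_eR => c s.
have n1 := cos2Dsin2 (tau * b').
apply: circle_inj; rewrite ?cX_eR ?cY_eR mulr0 mulrBr ?cos0 ?sin0 ?cosB ?sinB c s.
  by rewrite -!expr2.
by rewrite mulrC subrr.
Qed.

Lemma eR_surj z : exists b, eR b = z.
Proof.
have n1 := circle_norm z.
have X1 : -1 <= cX z <= 1.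
  by have Y0 := sqr_ge0 (cY z); apply/andP; split; nra.
pose a := acos (cX z).
have [Y0|Y0] := leP 0 (cY z).
  exists (a / tau); apply: circle_inj; rewrite ?cX_eR ?cY_eR mulrC divfK ?gt_eqF ?tau_gt0//.
    by rewrite acosK.
  by rewrite sin_acos// -n1 addrC addKr sqrtr_sqr ger0_norm.
exists (- (a / tau)); apply: circle_inj; rewrite ?cX_eR ?cY_eR mulrN mulrC divfK ?gt_eqF ?tau_gt0//.
  by rewrite cosN acosK.
by rewrite sinN sin_acos// -n1 addrC addKr sqrtr_sqr ltr0_norm// opprK.
Qed.

End Circle.

(** * Covering maps and the universal cover of the annulus *)

Lemma nbhs_subtype (X : topologicalType) (A : set X) (x : A) (U : set A) :
  nbhs x U -> exists W, [/\ open W, W (\val x) & forall y : A, W (\val y) -> U y].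
Proof.
case=> _ /= [] [W oW <- /= Wx sWU]; exists W; split => // y Wy; exact: sWU.
Qed.

Section CoveringMap.
Context (X Y : topologicalType) (f : X -> Y).
Hypothesis fcov : covering_map f.

Lemma covering_locally_injective : locally_injective f.
Proof.
have [_ _ ec] := fcov => e0; have [U [oU Ue0 [VV [fU _ oV homV]]]] := ec (f e0).
have [V VV0 Ve0] : (\bigcup_(V in VV) V) e0 by rewrite -fU.
exists V; split; first exact: oV.
  by [].
have [phi [psi [phiK _ phiE]]] := homV V VV0.
move=> e1 e2 V1 V2 f12.
pose v1 : V := exist _ e1 (mem_set V1); pose v2 : V := exist _ e2 (mem_set V2).
have : phi v1 = phi v2 by apply: val_inj; rewrite !phiE.
by move/(congr1 psi); rewrite !phiK => /(congr1 val).
Qed.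

Lemma covering_local_sections : local_sections f.
Proof.
have [_ _ ec] := fcov => y; have [U [oU Uy [VV [fU _ oV homV]]]] := ec y.
exists U; split=> // e0 Ue0.
have [V VV0 Ve0] : (\bigcup_(V in VV) V) e0 by rewrite -fU.
have [phi [psi [phiK psiK phiE]]] := homV V VV0.
(* The inverse of the sheet is extended to all of [Y] by the arbitrary value [e0]; only its values
   on [U] matter. *)
pose s u := if pselect (U u) is left h then \val (psi (exist _ u (mem_set h))) else e0.
have sE (u : Y) (h : U u) : s u = \val (psi (exist _ u (mem_set h))).
  by rewrite /s; case: pselect => // h'; rewrite (Prop_irrelevance h' h).
exists s; split.
- rewrite (sE _ Ue0).
  have -> : exist _ (f e0) (mem_set Ue0) = phi (exist _ e0 (mem_set Ve0)) :> U.
    by apply: val_inj; rewrite phiE.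
  by rewrite phiK.
- by move=> u h; rewrite (sE _ h) -phiE psiK.
move=> u h W; rewrite (sE _ h) => nW.
have c : continuous (fun v : U => \val (psi v)).
  exact: (continuousT_comp (@cts_fun _ _ psi) (@initial_continuous _ _ _)).
have /nbhs_subtype [G [oG Gu GW]] := c _ _ nW.
have : nbhs u (G `&` U) by apply: filterI; apply: open_nbhs_nbhs.
apply: filterS => v [Gv Uv]; rewrite /= (sE _ Uv).
exact: (GW (exist _ v (mem_set Uv))).
Qed.

End CoveringMap.

Section Annulus.
Context (R : realType).
Notation P := (R * R)%type.

Lemma continuous_at_affine (X : topologicalType) (f : X -> R) x a b :
  {for x, continuous f} -> {for x, continuous (fun x => a + f x / b)}.
Proof. by move=> cf; apply: cvgD; [exact: cvg_cst|apply: cvgM; [exact: cf|exact: cvg_cst]]. Qed.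

(** The scalar product of [z] and [z0] is the cosine of the angle between them, and [m z] below is
    its sine. On the open half circle centred at [z0] the cosine is positive, so the angle is the
    arcsine of [m z]. *)
Lemma circle_section (z0 : circle R) (b0 : R) : eR b0 = z0 ->
  exists s : circle R -> R, [/\ s z0 = b0,
    forall z, 0 < cX z * cX z0 + cY z * cY z0 -> eR (s z) = z &
    forall z, 0 < cX z * cX z0 + cY z * cY z0 -> {for z, continuous s}].
Proof.
move=> b0z0.
pose m z : R := cY z * cX z0 - cX z * cY z0.
have n0 := circle_norm z0.
have mn (z : circle R) : (cX z * cX z0 + cY z * cY z0) ^+ 2 + m z ^+ 2 = 1.
  transitivity ((cX z ^+ 2 + cY z ^+ 2) * (cX z0 ^+ 2 + cY z0 ^+ 2)); first by rewrite /m; ring.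
  by rewrite n0 circle_norm mulr1.
exists (fun z => b0 + asin (m z) / tau R); split.
- have -> : m z0 = 0 by rewrite /m; ring.
  have p0 := pi_gt0 R; rewrite -[X in asin X]sin0 sinK ?mul0r ?addr0//.
  by rewrite in_itv/=; apply/andP; split; lra.
- move=> z z0p; have mz := mn z.
  have m1 : -1 <= m z <= 1 by apply/andP; split; nra.
  have [sa ca] : sin (asin (m z)) = m z /\
      cos (asin (m z)) = cX z * cX z0 + cY z * cY z0.
    split; first by rewrite asinK.
    by rewrite cos_asin// -mz addrK sqrtr_sqr ger0_norm// ltW.
  have [cb sb] : cos (tau R * b0) = cX z0 /\ sin (tau R * b0) = cY z0 by rewrite -b0z0.
  apply: circle_inj; rewrite ?cX_eR ?cY_eR mulrDr [_ * (_ / _)]mulrC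
    divfK ?gt_eqF ?tau_gt0// ?cosD ?sinD sa ca cb sb /m.
    by rewrite -[RHS]mulr1 -n0; ring.
  by rewrite -[RHS]mulr1 -n0; ring.
- move=> z z0p; have mz := mn z.
  have cm : continuous m.
    by rewrite /m; apply: continuous_sub2; apply: continuous_mul2;
      first [exact: cX_continuous|exact: cY_continuous|exact: continuous_const].
  have ca : {for z, continuous (asin \o m)}.
    apply: (@continuous_comp _ _ _ m asin); first exact: cm.
    by apply: continuous_asin; apply/andP; split; nra.
  exact: continuous_at_affine ca.
Qed.

Lemma open_pos (X : topologicalType) (g : X -> R) : continuous g -> open [set x | 0 < g x].
Proof.
move=> cg; apply: (@open_comp _ _ g [set t | 0 < t]); last exact: open_gt.
by move=> x _; exact: cg.
Qed.

Lemma eR_local_sections : local_sections (@eR R).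
Proof.
move=> y; have [b by_] := eR_surj y.
exists [set z | 0 < cX z * cX y + cY z * cY y]; split.
- by apply: open_pos; apply: continuous_add2; apply: continuous_mul2;
    first [exact: cX_continuous|exact: cY_continuous|exact: continuous_const].
- by rewrite /= -!expr2 circle_norm.
move=> e0 /= e0U; have [s [s0 se sc]] := circle_section by_.
have [k kE] := eR_eq (se _ e0U).
exists (fun z => s z + k%:~R); split => //.
- by move=> u /se su; rewrite eR_int.
- move=> u /sc su; have := @continuous_at_affine _ s u k%:~R 1 su.
  by rewrite (_ : (fun x => _ + _ / _) = fun z => s z + k%:~R)//; apply/funext => x; rewrite divr1 addrC.
Qed.

Lemma intr_small (k : int) : `|k%:~R : R| < 1 -> k = 0.
Proof. by rewrite -intr_norm -[1]/(1%:~R) ltr_int; lia. Qed.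

Lemma eR_locally_injective : locally_injective (@eR R).
Proof.
move=> b; exists (ball b (2^-1)); split.
- exact: ball_open.
- exact: ballxx.
move=> b1 b2; rewrite /ball/= => h1 h2 /eR_eq[k kE]; subst b2.
have : `|k%:~R : R| < 1.
  have -> : k%:~R = (b - b1) - (b - (b1 + k%:~R)) :> R by ring.
  by apply: le_lt_trans (ler_normB _ _) _; lra.
by move/intr_small => ->; rewrite addr0.
Qed.

Lemma R_hausdorff : hausdorff_space R.
Proof. exact: norm_hausdorff. Qed.

Lemma eR_lift (q : P -> circle R) (z0 : P) b0 : continuous q -> eR b0 = q z0 ->
  exists g : P -> R, [/\ continuous g, g z0 = b0 & forall z, eR (g z) = q z].
Proof.
by move=> cq; apply: lift_plane cq _ _; [exact: R_hausdorff|exact: eR_local_sections|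
  exact: eR_locally_injective].
Qed.

Lemma prod_hausdorff (X Y : topologicalType) :
  hausdorff_space X -> hausdorff_space Y -> hausdorff_space (X * Y)%type.
Proof.
rewrite !open_hausdorff => hX hY [x y] [x' y'] /eqP neq.
have [xx'|/hX] := eqVneq x x'.
  have /hY[[A B]/= [yA yB] [oA oB /eqP AB]] : y != y'.
    by apply/eqP => yy'; apply: neq; rewrite xx' yy'.
  exists (snd @^-1` A, snd @^-1` B) => /=; first by move: yA yB; rewrite !inE.
  split; [| |apply/eqP].
  - by apply: open_comp => // ? _; exact: continuous_snd.
  - by apply: open_comp => // ? _; exact: continuous_snd.
  - apply/seteqP; split => // -[a b] [/= Ab Bb].
    by have : (A `&` B : set Y) b by []; rewrite AB.
move=> [[A B]/= [yA yB] [oA oB /eqP AB]].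
exists (fst @^-1` A, fst @^-1` B) => /=; first by move: yA yB; rewrite !inE.
split; [| |apply/eqP].
- by apply: open_comp => // ? _; exact: continuous_fst.
- by apply: open_comp => // ? _; exact: continuous_fst.
- apply/seteqP; split => // -[a b] [/= Ab Bb].
  by have : (A `&` B : set X) a by []; rewrite AB.
Qed.

Lemma subtype_hausdorff (X : topologicalType) (A : set X) :
  hausdorff_space X -> hausdorff_space A.
Proof.
rewrite !open_hausdorff => hX x y xy.
have /hX[[B C]/= [xB yC] [oB oC /eqP BC]] : \val x != \val y.
  by apply: contra xy => /eqP xy; apply/eqP/val_inj.
exists ((fun x : A => \val x) @^-1` B, (fun x : A => \val x) @^-1` C) => /=.
  by move: xB yC; rewrite !inE.
split; [| |apply/eqP].
- by apply: open_comp => // ? _; exact: initial_continuous.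
- by apply: open_comp => // ? _; exact: initial_continuous.
- apply/seteqP; split => // z [/= Bz Cz].
  by have : (B `&` C : set X) (\val z) by []; rewrite BC.
Qed.

Lemma annulus_hausdorff : hausdorff_space (annulus R).
Proof.
apply: prod_hausdorff; apply: subtype_hausdorff; first exact: R_hausdorff.
exact: norm_hausdorff.
Qed.

Definition height (p : annulus R) : R := \val p.1.

Lemma height_continuous : continuous height.
Proof.
have c : continuous (fun p : annulus R => p.1) by exact: continuous_fst.
exact: (continuousT_comp c (@initial_continuous _ _ _)).
Qed.

Lemma angle_continuous : continuous (fun p : annulus R => p.2 : circle R).
Proof. exact: continuous_snd. Qed.

Lemma annulus_inj (p q : annulus R) : height p = height q -> p.2 = q.2 -> p = q.
Proof. by case: p => a b; case: q => c d /= h ->; congr pair; exact: val_inj. Qed.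

Lemma height_itv p : 0 < height p < 1.
Proof. by have := valP p.1; rewrite inE /= in_itv. Qed.

(* A homeomorphism from [R] onto (0, 1), which makes the whole plane the
   universal cover of the annulus. *)
Definition squash (a : R) : R := (1 + a / (1 + `|a|)) / 2.

Lemma squash_itv a : squash a \in (`]0, 1[%classic : set R).
Proof.
rewrite inE /= in_itv/= /squash.
have a1 : 0 < 1 + `|a| by rewrite ltr_pwDl.
have : `|a / (1 + `|a|)| < 1.
  by rewrite normrM normfV (gtr0_norm a1) ltr_pdivrMr// mul1r ltrDr.
by rewrite ltr_norml => /andP[? ?]; apply/andP; split; lra.
Qed.

Lemma continuous_inv2 (X : topologicalType) (f : X -> R) :
  (forall x, f x != 0) -> continuous f -> continuous (fun x => (f x)^-1).
Proof. by move=> f0 cf x; apply: cvgV; [exact: f0|exact: cf]. Qed.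

Lemma continuous_norm2 (X : topologicalType) (f : X -> R) :
  continuous f -> continuous (fun x => `|f x|).
Proof. by move=> cf x; apply: cvg_norm; exact: cf. Qed.

Lemma squash_continuous : continuous squash.
Proof.
apply: continuous_mul2; last exact: continuous_const.
apply: continuous_add2; first exact: continuous_const.
apply: continuous_mul2; first exact: continuous_id.
apply: continuous_inv2; first by move=> a; rewrite gt_eqF// ltr_pwDl.
by apply: continuous_add2; [exact: continuous_const|apply: continuous_norm2; exact: continuous_id].
Qed.

Definition unsquash (x : R) : R := (2 * x - 1) / (1 - `|2 * x - 1|).

Lemma unsquash_den (x : R) : 0 < x < 1 -> 0 < 1 - `|2 * x - 1|.
Proof.
by move=> /andP[? ?]; rewrite subr_gt0 ltr_norml; apply/andP; split; lra.
Qed.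

Lemma unsquash_itvK x : 0 < x < 1 -> squash (unsquash x) = x.
Proof.
move=> x01; have d0 := unsquash_den x01; rewrite /squash /unsquash.
set u := 2 * x - 1 in d0 *.
rewrite normrM normfV (gtr0_norm d0).
have -> : 1 + `|u| / (1 - `|u|) = (1 - `|u|)^-1 by field; rewrite gt_eqF.
by rewrite invrK divfK ?gt_eqF// /u; field.
Qed.

Lemma squashK a : unsquash (squash a) = a.
Proof.
rewrite /squash /unsquash.
have a1 : 0 < 1 + `|a| by rewrite ltr_pwDl.
have -> : 2 * ((1 + a / (1 + `|a|)) / 2) - 1 = a / (1 + `|a|) by field; rewrite gt_eqF.
rewrite normrM normfV (gtr0_norm a1).
by field; rewrite gt_eqF//= ; apply/eqP; lra.
Qed.

Lemma continuous_unsquash (X : topologicalType) (f : X -> R) :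
  (forall x, 0 < f x < 1) -> continuous f -> continuous (fun x => unsquash (f x)).
Proof.
move=> f01 cf.
have cu : continuous (fun x => 2 * f x - 1) by cts.
apply: continuous_mul2 => //; apply: continuous_inv2.
  by move=> x; rewrite gt_eqF// unsquash_den.
by apply: continuous_sub2; [exact: continuous_const|exact: continuous_norm2].
Qed.

Definition cov (z : P) : annulus R :=
  (exist _ (squash z.1) (squash_itv z.1), eR z.2).

Lemma height_cov z : height (cov z) = squash z.1. Proof. by []. Qed.

Lemma annulus_continuous (X : topologicalType) (f : X -> annulus R) :
  continuous (fun x => height (f x)) -> continuous (fun x => (f x).2 : circle R) -> continuous f.
Proof.
move=> f1 f2.
have c1 : continuous (fun x => (f x).1) by apply: continuous_comp_initial.
have -> : f = fun x => ((f x).1, (f x).2) by apply/funext => x; case: (f x).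
exact: continuous_pair.
Qed.

Lemma cov_continuous : continuous cov.
Proof.
apply: annulus_continuous.
  exact: (continuousT_comp (@continuous_fst _ _) squash_continuous).
exact: (continuousT_comp (@continuous_snd _ _) (@eR_continuous R)).
Qed.

Definition shift (k : int) (z : P) : P := (z.1, z.2 + k%:~R).

Lemma cov_shift k z : cov (shift k z) = cov z.
Proof. by apply: annulus_inj => //=; exact: eR_int. Qed.

Lemma cov_eq z w : cov z = cov w -> exists k, w = shift k z.
Proof.
move=> zw; have /(congr1 unsquash) := congr1 height zw.
rewrite !height_cov !squashK => zw1.
have /eR_eq[k kE] := congr1 snd zw; exists k.
by rewrite /shift zw1 -kE; case: w {zw zw1 kE}.
Qed.

Lemma cov_surj p : exists z, cov z = p.
Proof.
have [b bp] := eR_surj (p.2 : circle R).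
exists (unsquash (height p), b); apply: annulus_inj => //.
by rewrite height_cov /= unsquash_itvK// height_itv.
Qed.

(** On heights [cov] is a homeomorphism onto (0, 1), so only the angle has to be lifted. *)
Lemma cov_lift (q : P -> annulus R) (z0 w0 : P) : continuous q -> cov w0 = q z0 ->
  exists g : P -> P, [/\ continuous g, g z0 = w0 & forall z, cov (g z) = q z].
Proof.
move=> cq w0z0.
have cq2 : continuous (fun z => (q z).2 : circle R) by exact: (continuousT_comp cq angle_continuous).
have cq1 : continuous (fun z => height (q z)) by exact: (continuousT_comp cq height_continuous).
have [|g [cg g0 gq]] := @eR_lift _ z0 w0.2 cq2; first by rewrite -w0z0.
exists (fun z => (unsquash (height (q z)), g z)); split.
- apply: continuous_pair => //; apply: continuous_unsquash => // z; exact: height_itv.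
- by rewrite g0 -w0z0 height_cov squashK; case: (w0).
- move=> z; apply: annulus_inj; last exact: gq.
  by rewrite height_cov/= unsquash_itvK// height_itv.
Qed.

Lemma shift_continuous k : continuous (shift k).
Proof. by rewrite /shift; cts. Qed.

Lemma shiftD j k z : shift j (shift k z) = shift (k + j) z.
Proof. by rewrite /shift/= intrD addrA. Qed.

Lemma shift0 z : shift 0 z = z.
Proof. by rewrite /shift/= addr0; case: z. Qed.

End Annulus.

(** * Crossing paths *)

Section Crossing.
Context (R : realType).
Notation P := (R * R)%type.

Lemma IVT_total (f : R -> R) a b v : continuous f -> f a <= v <= f b ->
  exists c, f c = v.
Proof.
move=> cf /andP[av vb].
have cw (x y : R) : {within `[x, y], continuous f} by apply: continuous_subspaceT.
have [ab|/ltW ba] := leP a b.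
  have [|c _ fc] := IVT ab (cw _ _) (v := v); last by exists c.
  by rewrite ge_min av le_max vb orbT.
have [|c _ fc] := IVT ba (cw _ _) (v := v); last by exists c.
by rewrite ge_min av le_max vb !orbT.
Qed.

Lemma cos_half_neg : cos (tau R * 2^-1) < 0.
Proof.
have -> : tau R * 2^-1 = pi by rewrite /tau; field.
by rewrite cospi ltrN10.
Qed.

(** Let [m] be an integer nearest to [f 0]. The difference [f t - m] cannot reach a half integer,
    where the cosine would be -1, so it stays in (-1/2, 1/2); there a nonnegative cosine forces it
    into [-1/4, 1/4]. *)
Lemma int_of_cos_ge0 (f : R -> R) : continuous f -> (forall t, 0 <= cos (tau R * f t)) ->
  exists m : int, forall t, m%:~R - 4^-1 <= f t <= m%:~R + 4^-1.
Proof.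
move=> cf fc; pose m := Num.floor (f 0 + 2^-1); exists m.
pose g t := f t - m%:~R.
have cg : continuous g by rewrite /g; cts.
have gc t : 0 <= cos (tau R * g t).
  by rewrite -cX_eR /g -mulrNz eR_int cX_eR.
have gne t : g t != 2^-1 /\ g t != - 2^-1.
  split; apply/eqP => gt; have := gc t; rewrite gt.
    by rewrite leNgt cos_half_neg.
  by rewrite mulrN cosN leNgt cos_half_neg.
have g0 : - 2^-1 <= g 0 < 2^-1.
  have := floor_le (f 0 + 2^-1); have := floorD1_gt (f 0 + 2^-1).
  by rewrite intrD -/m /g => ? ?; apply/andP; split; lra.
have gt t : - 2^-1 < g t < 2^-1.
  move: g0 => /andP[g00 g01].
  apply/andP; split; rewrite ltNge; apply/negP => h.
    have [|c gcE] := @IVT_total g t 0 (- 2^-1) cg; first by rewrite h g00.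
    by have [_] := gne c; rewrite gcE eqxx.
  have [|c gcE] := @IVT_total g 0 t (2^-1) cg; first by rewrite h ltW.
  by have [] := gne c; rewrite gcE eqxx.
move=> t; suff : `|g t| <= 4^-1.
  by rewrite ler_norml /g => /andP[? ?]; apply/andP; split; lra.
rewrite leNgt; apply/negP => h.
have := gc t; rewrite -cos_norm normrM (gtr0_norm (tau_gt0 R)); apply/negP.
have p0 := pi_gt0 R.
have g1 : `|g t| < 2^-1 by rewrite ltr_norml.
have h1 : 0 < pi * (2^-1 - `|g t|) by rewrite mulr_gt0// subr_gt0.
rewrite mulrBr in h1.
have h2 : 0 < pi * (`|g t| - 4^-1) by rewrite mulr_gt0// subr_gt0.
rewrite mulrBr in h2; have h3 : 0 <= pi * `|g t| by rewrite mulr_ge0// ltW.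
have in1 : (pi + pi) * `|g t| \in `[0, pi] by rewrite in_itv/= mulrDl; apply/andP; split; lra.
have in2 : pi / 2 \in `[0, (pi : R)] by rewrite in_itv/=; apply/andP; split; lra.
suff : cos (tau R * `|g t|) < cos (pi / 2) by rewrite cos_pihalf => /lt_geF ->.
by rewrite /tau mulr2n ltr_cos// [ltRHS]mulrDl; lra.
Qed.

Lemma int_eq (m n : int) : m%:~R - 1 < (n%:~R : R) < m%:~R + 1 -> n = m.
Proof.
move=> mn; suff : n - m = 0 by move/eqP; rewrite subr_eq0 => /eqP.
by apply: (@intr_small R); rewrite intrB ltr_norml; move: mn => /andP[? ?]; apply/andP; split; lra.
Qed.

Lemma int_eq_quarter (m n : int) (x y : R) : m%:~R - 4^-1 <= x <= m%:~R + 4^-1 ->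
  n%:~R - 4^-1 <= y <= n%:~R + 4^-1 -> x - y = 4^-1 -> n = m.
Proof. by move=> /andP[? ?] /andP[? ?] ?; apply: int_eq; apply/andP; split; lra. Qed.

Lemma three_quarters (m x : R) : m - 4^-1 <= x <= m + 4^-1 ->
  m - 4^-1 <= x - 3 * 4^-1 <= m + 4^-1 -> False.
Proof. by move=> /andP[? ?] /andP[? ?]; lra. Qed.

(* Poincare-Miranda: if the paths are disjoint, the angle of [g u - s t] is a
   continuous function on the square which stays in a half turn along each side;
   the four half turns overlap so as to add up to a full turn around the boundary. *)
Lemma paths_cross (g s : R -> P) (M T : R) :
  continuous g -> continuous s ->
  (forall t, - M <= (g t).1 <= M) -> (forall t, - T <= (s t).2 <= T) ->
  (s 0).1 <= - M -> M <= (s 1).1 -> (g 0).2 <= - T -> T <= (g 1).2 ->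
  exists t u, g t = s u.
Proof.
move=> cg cs gM sT s0 s1 g0 g1; apply: contrapT => disj.
pose d1 (z : P) := (g z.2).1 - (s z.1).1.
pose d2 (z : P) := (g z.2).2 - (s z.1).2.
have cd1 : continuous d1 by rewrite /d1; cts.
have cd2 : continuous d2 by rewrite /d2; cts.
pose n z := Num.sqrt (d1 z ^+ 2 + d2 z ^+ 2).
have n0 z : 0 < n z.
  rewrite sqrtr_gt0 lt_neqAle addr_ge0 ?sqr_ge0// andbT eq_sym.
  rewrite paddr_eq0 ?sqr_ge0// !sqrf_eq0 !subr_eq0; apply/negP => /andP[/eqP e1 /eqP e2].
  by apply: disj; exists z.2, z.1; case: (g _) e1 e2 => ? ?; case: (s _) => ? ? /= -> ->.
have cn : continuous n.
  have c : continuous (fun z => d1 z ^+ 2 + d2 z ^+ 2) by cts.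
  exact: (continuousT_comp c (@sqrt_continuous R)).
have nE z : (d1 z / n z) ^+ 2 + (d2 z / n z) ^+ 2 = 1.
  have n2 : n z ^+ 2 = d1 z ^+ 2 + d2 z ^+ 2 by rewrite sqr_sqrtr// addr_ge0 ?sqr_ge0.
  by rewrite !expr_div_n -mulrDl -n2 divff// expf_neq0// gt_eqF.
pose q z := circ (nE z).
have cq : continuous q.
  have ci : continuous (fun z => (n z)^-1) by apply: continuous_inv2 => // z; rewrite gt_eqF.
  apply: circle_continuous; [exact: (continuous_mul2 cd1 ci)|exact: (continuous_mul2 cd2 ci)].
have [b0 b0q] := eR_surj (q (0, 0)).
have [a [ca _ aq]] := eR_lift cq b0q.
have cosa z : cos (tau R * a z) = d1 z / n z by rewrite -cX_eR aq.
have sina z : sin (tau R * a z) = d2 z / n z by rewrite -cY_eR aq.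
have tau4 : tau R * 4^-1 = pi / 2 by rewrite /tau; field.
have tau2 : tau R * 2^-1 = pi by rewrite /tau; field.
have ni z : 0 <= (n z)^-1 by rewrite invr_ge0 ltW.
(* Along the four sides the vector [g u - s t] points in turn to the right, upwards, to the left and
   downwards, so the angle [a] is within a quarter turn of 0, 1/4, 1/2 and 3/4 modulo integers. *)
have [m0 m0P] : exists m : int, forall t, m%:~R - 4^-1 <= a (0, t) <= m%:~R + 4^-1.
  apply: (@int_of_cos_ge0 (fun t => a (0, t))); first by cts.
  move=> t; rewrite cosa mulr_ge0// /d1/=; have /andP[? ?] := gM t; lra.
have [m1 m1P] : exists m : int, forall t, m%:~R - 4^-1 <= a (t, 1) - 4^-1 <= m%:~R + 4^-1.
  apply: (@int_of_cos_ge0 (fun t => a (t, 1) - 4^-1)); first by cts.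
  move=> t; rewrite mulrBr tau4 cosBpihalf sina mulr_ge0// /d2/=; have /andP[? ?] := sT t; lra.
have [m2 m2P] : exists m : int, forall t, m%:~R - 4^-1 <= a (1, t) - 2^-1 <= m%:~R + 4^-1.
  apply: (@int_of_cos_ge0 (fun t => a (1, t) - 2^-1)); first by cts.
  move=> t; rewrite mulrBr tau2.
  have -> : tau R * a (1, t) - pi = tau R * a (1, t) - pi / 2 - pi / 2 by field.
  rewrite cosBpihalf sinBpihalf cosa -mulNr mulr_ge0// /d1/=.
  by have /andP[? ?] := gM t; lra.
have [m3 m3P] : exists m : int, forall t, m%:~R - 4^-1 <= a (t, 0) - 3 * 4^-1 <= m%:~R + 4^-1.
  apply: (@int_of_cos_ge0 (fun t => a (t, 0) - 3 * 4^-1)); first by cts.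
  move=> t; rewrite mulrBr mulrCA tau4.
  have -> : tau R * a (t, 0) - 3 * (pi / 2) = tau R * a (t, 0) - pi / 2 - pi / 2 - pi / 2 by field.
  rewrite cosBpihalf sinBpihalf cosBpihalf sina -mulNr mulr_ge0// /d2/=.
  by have /andP[? ?] := sT t; lra.
(* At a common corner two consecutive integers differ by at most 3/4, hence are equal. Back at
   [(0, 0)] the accumulated offset 3/4 exceeds the permitted 1/2. *)
have E1 : m1 = m0 by apply: (int_eq_quarter (m0P 1) (m1P 0)); field.
have E2 : m2 = m1 by apply: (int_eq_quarter (m1P 1) (m2P 1)); field.
have E3 : m3 = m2 by apply: (int_eq_quarter (m2P 0) (m3P 1)); field.
have := m3P 0; rewrite E3 E2 E1; exact: three_quarters (m0P 0).
Qed.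

Lemma path_bounded (g : R -> R) : continuous g -> (forall t, g t = g (clamp t)) ->
  exists T, forall t, - T <= g t <= T.
Proof.
move=> cg gc.
have cw : {within `[0, 1], continuous g} by apply: continuous_subspaceT.
have [c _ cmax] := EVT_max ler01 cw.
have [e _ emin] := EVT_min ler01 cw.
exists (`|g c| + `|g e|) => t; rewrite (gc t).
have t01 : clamp t \in `[0, 1] by rewrite in_itv/= clamp_itv.
have := cmax _ t01; have := emin _ t01.
have := ler_norm (g c); have := ler_norm (- g e); rewrite normrN.
have := normr_ge0 (g c); have := normr_ge0 (g e).
by move=> ? ? ? ? ? ?; apply/andP; split; lra.
Qed.

(** The vertical extent of [G] is required for every [T], because the height reached by the path in
    [K] is known only once that path has been chosen. *)
Lemma pconn_cross (G K : set P) (M : R) z w :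
  (forall y, G y -> - M <= y.1 <= M) ->
  (forall T, exists x y, [/\ x.2 <= - T, T <= y.2 & pconn G x y]) ->
  z.1 <= - M -> M <= w.1 -> pconn K z w -> exists p, G p /\ K p.
Proof.
move=> GM GT zM wM [s [cs s0 s1 sK]].
have cs2 : continuous (fun t => (s t).2) by cts.
have [T sT] : exists T, forall t, - T <= (s t).2 <= T.
  apply: path_bounded => // t.
  have [t0|t0] := leP t 0; first by rewrite clamp_le0// !s0.
  have [t1|t1] := leP 1 t; first by rewrite clamp_ge1// !s1.
  by rewrite clamp_id// !ltW.
have [x [y [xT yT [g [cg g0 g1 gG]]]]] := GT T.
have [||||t [u tu]] := @paths_cross g s M T cg cs (fun t => GM _ (gG t)) sT.
- by rewrite s0.
- by rewrite s1.
- by rewrite g0.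
- by rewrite g1.
- by exists (g t); split=> //; rewrite tu.
Qed.

End Crossing.

(** * Singular homology of the annulus *)

Section Simplices.
Context (R : realType).
Notation P := (R * R)%type.

Definition coord n (i : 'I_n.+1) (t : simplex R n) : R := (\val t) ord0 i.

Lemma coord_continuous_simplex n i : continuous (@coord n i).
Proof.
apply: (@continuousT_comp _ _ _ (fun t : simplex R n => \val t)
  (fun M : 'rV[R]_n.+1 => M ord0 i)); first exact: initial_continuous.
exact: coord_continuous.
Qed.

Lemma coord_inj n (t u : simplex R n) : (forall i, coord i t = coord i u) -> t = u.
Proof. by move=> tu; apply: val_inj; apply/rowP => i; exact: tu. Qed.

Lemma row_continuous (X : topologicalType) n (f : 'I_n.+1 -> X -> R) :
  (forall i, continuous (f i)) -> continuous (fun x => \row_i f i x : 'rV[R]_n.+1).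
Proof.
move=> cf x U [Q Qx QU].
suff : \forall y \near x, forall j k, Q j k ((\row_i f i y) j k).
  by apply: filterS => s Ps; exact: QU.
apply: (@filter_forall _ _ (fun j y => forall k, Q j k ((\row_i f i y) j k)) (nbhs x)) => j.
apply: (@filter_forall _ _ (fun k y => Q j k ((\row_i f i y) j k)) (nbhs x)) => k.
have h : nbhs x (f k @^-1` Q j k) by apply: cf; have := Qx j k; rewrite mxE.
by apply: filterS h => y /=; rewrite mxE.
Qed.

Lemma mk1_subproof (s : R) :
  (\row_(i < 2) (if i == ord0 then 1 - clamp s else clamp s)) \in simplex R 1.
Proof.
have /andP[c0 c1] := clamp_itv s; apply/mem_set; split => [i|].
  by rewrite mxE; case: ifP => // _; rewrite subr_ge0.
by rewrite !big_ord_recl big_ord0 !mxE /= addr0 subrK.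
Qed.

Definition mk1 (s : R) : simplex R 1 := exist (fun t => t \in simplex R 1) _ (mk1_subproof s).

Lemma mk1_continuous : continuous mk1.
Proof.
apply: continuous_comp_initial; apply: row_continuous => i.
by case: (i == ord0) => /=; cts.
Qed.

Lemma coord1_mk1 s : coord (fintype.lift ord0 ord0) (mk1 s) = clamp s.
Proof. by rewrite /coord mxE. Qed.

Lemma coord_simplex1 (t : simplex R 1) :
  coord ord0 t = 1 - coord (fintype.lift ord0 ord0) t /\ 0 <= coord (fintype.lift ord0 ord0) t <= 1.
Proof.
have /set_mem [t0] := valP t; rewrite !big_ord_recl big_ord0 addr0 => t1.
have h1 := t0 (fintype.lift ord0 ord0); have h0 := t0 ord0.
rewrite /coord; split; first by rewrite -t1 addrK.
by rewrite h1/= -t1 lerDr.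
Qed.

Lemma mk1K (t : simplex R 1) : mk1 (coord (fintype.lift ord0 ord0) t) = t.
Proof.
have [t0 t1] := coord_simplex1 t.
apply: coord_inj => i; rewrite {1}/coord mxE clamp_id//.
by case: (unliftP ord0 i) => [j ->|-> //]; rewrite [j]ord1.
Qed.

(* [mk1] and [mk2] retract the line and the plane onto the simplices, in the
   coordinates of index at least 1. *)
Definition tri_y (z : P) : R := Num.max 0 (Num.min z.2 (1 - clamp z.1)).

Lemma mk2_subproof (z : P) : (\row_(i < 3) (if i == ord0 then 1 - clamp z.1 - tri_y z
   else if i == fintype.lift ord0 ord0 then clamp z.1 else tri_y z)) \in simplex R 2.
Proof.
have /andP[c0 c1] := clamp_itv z.1.
have y0 : 0 <= tri_y z by rewrite /tri_y le_max lexx.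
have y1 : tri_y z <= 1 - clamp z.1 by rewrite /tri_y ge_max subr_ge0 c1 ge_min lexx orbT.
apply/mem_set; split => [i|].
  by rewrite mxE; case: ifP => // _; [lra|case: ifP].
by rewrite !big_ord_recl big_ord0 !mxE /=; ring.
Qed.

Definition mk2 (z : P) : simplex R 2 := exist (fun t => t \in simplex R 2) _ (mk2_subproof z).

Lemma mk2_continuous : continuous mk2.
Proof.
apply: continuous_comp_initial; apply: row_continuous => i; rewrite /tri_y.
by case: (i == ord0) => /=; [|case: (i == fintype.lift ord0 ord0) => /=]; cts.
Qed.

Definition i1 : 'I_3 := fintype.lift ord0 ord0.
Definition i2 : 'I_3 := fintype.lift ord0 (fintype.lift ord0 ord0).

Lemma unlift_i1i2 : [/\ unlift i1 ord0 = Some ord0, unlift i1 i1 = None,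
  unlift i1 i2 = Some (fintype.lift ord0 ord0), unlift i2 ord0 = Some ord0 &
  unlift i2 i1 = Some (fintype.lift ord0 ord0) /\ unlift i2 i2 = None].
Proof.
have E h j i : i = fintype.lift h j :> 'I_3 -> unlift h i = Some j by move=> ->; rewrite liftK.
by do ![split]; rewrite ?unlift_none//; apply: E; apply: val_inj.
Qed.

Lemma face_mk2 (s : R) : 0 <= s <= 1 ->
  [/\ face R (ord0 : 'I_3) (mk1 s) = mk2 (1 - s, s),
      face R i1 (mk1 s) = mk2 (0, s) & face R i2 (mk1 s) = mk2 (s, 0)].
Proof.
move=> /andP[s0 s1].
have cs : clamp s = s by rewrite clamp_id// s0.
have cs1 : clamp (1 - s) = 1 - s by rewrite clamp_id//; apply/andP; split; lra.
have c0 : clamp 0 = 0 :> R by rewrite clamp_id// lexx ler01.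
have m0 : Num.max 0 (Num.min s (1 - (1 - s))) = s by rewrite subKr minxx max_r.
have m1 : Num.max 0 (Num.min s (1 - 0)) = s by rewrite subr0 min_l// max_r.
have m2 : Num.max 0 (Num.min 0 (1 - s)) = 0 by rewrite min_l ?maxxx// subr_ge0.
have [u10 u11 u12 u20 [u21 u22]] := unlift_i1i2.
split; apply: val_inj; apply/rowP => i; rewrite /= !mxE /tri_y/= ?cs1 ?cs ?c0 ?m0 ?m1 ?m2.
all: case: (unliftP ord0 i) => [j ->|->]; last first.
all: try (case: (unliftP ord0 j) => [k ->|->]; rewrite ?[k]ord1).
all: rewrite ?(u10, u11, u12, u20, u21, u22) ?unlift_none ?liftK ?mxE/= ?cs.
all: by ring.
Qed.

Definition vx (x : 'I_2) : simplex R 0 -> simplex R 1 := face R x.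

Lemma vertexE (t : simplex R 0) : vx ord0 t = mk1 1 /\ vx (fintype.lift ord0 ord0) t = mk1 0.
Proof.
have /set_mem [_] := valP t; rewrite big_ord_recl big_ord0 addr0 => t0.
have c0 : clamp 0 = 0 :> R by rewrite clamp_id// lexx ler01.
have c1 : clamp 1 = 1 :> R by rewrite clamp_id// lexx ler01.
split; apply: val_inj; apply/rowP => i; rewrite /= !mxE ?c0 ?c1 ?subrr ?subr0.
  case: (unliftP ord0 i) => [j ->|->]; rewrite ?unlift_none ?liftK//.
  by rewrite [j]ord1 t0.
case: (unliftP ord0 i) => [j ->|->].
  by rewrite [j]ord1 unlift_none.
have -> : ord0 = fintype.lift (fintype.lift ord0 ord0 : 'I_2) (ord0 : 'I_1) by apply: val_inj.
by rewrite liftK t0.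
Qed.

End Simplices.

Section SingularChains.
Context (R : realType) (X : topologicalType).
Notation P := (R * R)%type.

Definition sing0 (x : X) : singular R 0 X := mkcts (@continuous_const _ _ x).

Lemma sing1_subproof (g : R -> X) : continuous g ->
  continuous (fun t : simplex R 1 => g (coord (fintype.lift ord0 ord0) t)).
Proof. by move=> cg; exact: (continuousT_comp (@coord_continuous_simplex R 1 _) cg). Qed.

Definition sing1 (g : R -> X) (cg : continuous g) : singular R 1 X :=
  mkcts (sing1_subproof cg).

Lemma sing2_subproof (g : P -> X) : continuous g ->
  continuous (fun t : simplex R 2 => g (coord (i1 : 'I_3) t, coord (i2 : 'I_3) t)).
Proof.
move=> cg; have c := continuous_pair (@coord_continuous_simplex R 2 i1) (@coord_continuous_simplex R 2 i2).
exact: (continuousT_comp c cg).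
Qed.

Definition sing2 (g : P -> X) (cg : continuous g) : singular R 2 X :=
  mkcts (sing2_subproof cg).

Lemma boundary1 (s : singular R 1 X) :
  boundary << s >> = << sing0 (s (mk1 1)) >> - << sing0 (s (mk1 0)) >>.
Proof.
rewrite /boundary liftU scale1r !big_ord_recl big_ord0 addr0 expr0 expr1 scale1r scaleN1r.
congr (_ - _); congr << _ >>; apply/continuousEP => t /=; congr (s _).
  by have [] := vertexE t.
by have [] := vertexE t.
Qed.

Lemma boundary2 (s : singular R 2 X) (s0 s1 s2 : singular R 1 X) :
  (forall t, 0 <= t <= 1 -> s0 (mk1 t) = s (mk2 (1 - t, t))) ->
  (forall t, 0 <= t <= 1 -> s1 (mk1 t) = s (mk2 (0, t))) ->
  (forall t, 0 <= t <= 1 -> s2 (mk1 t) = s (mk2 (t, 0))) ->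
  boundary << s >> = << s0 >> - << s1 >> + << s2 >>.
Proof.
move=> e0 e1 e2; rewrite /boundary liftU scale1r !big_ord_recl big_ord0 addr0.
rewrite expr0 expr1 scale1r scaleN1r -[(-1) ^+ _]/(1 : int) scale1r addrA.
have E (u v : singular R 1 X) : (forall t, 0 <= t <= 1 -> u (mk1 t) = v (mk1 t)) ->
    << v >> = << u >> :> chain R 1 X.
  move=> uv; congr << _ >>; apply/continuousEP => t.
  by have [_ t01] := coord_simplex1 t; rewrite -(mk1K t) uv.
by congr (_ - _ + _); apply: E => t t01 /=; have [f0 f1 f2] := face_mk2 t01;
  rewrite ?f0 ?f1 ?f2 ?e0 ?e1 ?e2.
Qed.

End SingularChains.

Section Homologous.
Context (R : realType) (X : topologicalType).
Notation P := (R * R)%type.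
Implicit Types (a b c : chain R 1 X).

(** Meant for arbitrary chains and not just for cycles, so that single paths can be cut,
    straightened and rerouted. *)
Definition homologous a b := exists e : chain R 2 X, boundary e = a - b.

Lemma homologous_refl a : homologous a a.
Proof. by exists 0; rewrite raddf0 subrr. Qed.

Lemma homologous_sym a b : homologous a b -> homologous b a.
Proof. by move=> [e eE]; exists (- e); rewrite raddfN/= eE opprB. Qed.

Lemma homologous_trans a b c : homologous a b -> homologous b c -> homologous a c.
Proof. by move=> [e eE] [f fE]; exists (e + f); rewrite raddfD/= eE fE addrA subrK. Qed.

Lemma homologousD a b a' b' :
  homologous a b -> homologous a' b' -> homologous (a + a') (b + b').
Proof.
by move=> [e eE] [f fE]; exists (e + f); rewrite raddfD/= eE fE opprD addrACA.
Qed.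

Lemma homologousN a b : homologous a b -> homologous (- a) (- b).
Proof. by move=> [e eE]; exists (- e); rewrite raddfN/= eE opprD. Qed.

Definition arc (g : R -> X) (cg : continuous g) : chain R 1 X := << sing1 cg >>.

Lemma arc_ext (g h : R -> X) (cg : continuous g) (ch : continuous h) :
  (forall t, 0 <= t <= 1 -> g t = h t) -> arc cg = arc ch.
Proof.
move=> gh; rewrite /arc; congr << _ >>; apply/continuousEP => t /=; apply: gh.
by have [] := coord_simplex1 t.
Qed.

Lemma coord_mk2 (z : P) : 0 <= z.1 -> 0 <= z.2 -> z.1 + z.2 <= 1 ->
  (coord (i1 : 'I_3) (mk2 z), coord (i2 : 'I_3) (mk2 z)) = z.
Proof.
case: z => x y /= x0 y0 xy; have x1 : clamp x = x by rewrite clamp_id// x0/=; lra.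
by rewrite /coord !mxE /= /tri_y /= x1 min_l ?max_r//; lra.
Qed.

Lemma sing1_mk1 (g : R -> X) (cg : continuous g) t : 0 <= t <= 1 -> sing1 cg (mk1 t) = g t.
Proof.
by move=> t01; rewrite -[LHS]/(g (coord (fintype.lift ord0 ord0) (mk1 t))) coord1_mk1 clamp_id.
Qed.

Lemma sing2_mk2 (g : P -> X) (cg : continuous g) (z : P) :
  0 <= z.1 -> 0 <= z.2 -> z.1 + z.2 <= 1 -> sing2 cg (mk2 z) = g z.
Proof.
move=> z1 z2 z12; rewrite -[LHS]/(g (coord (i1 : 'I_3) (mk2 z), coord (i2 : 'I_3) (mk2 z))).
by rewrite coord_mk2.
Qed.

Lemma homologous_triangle (H : P -> X) (cH : continuous H)
    (g0 g1 g2 : R -> X) (c0 : continuous g0) (c1 : continuous g1) (c2 : continuous g2) :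
  (forall t, 0 <= t <= 1 -> g0 t = H (1 - t, t)) ->
  (forall t, 0 <= t <= 1 -> g1 t = H (0, t)) ->
  (forall t, 0 <= t <= 1 -> g2 t = H (t, 0)) ->
  homologous (arc c2 + arc c0) (arc c1).
Proof.
move=> e0 e1 e2; exists << sing2 cH >>.
rewrite (@boundary2 _ _ _ (sing1 c0) (sing1 c1) (sing1 c2)).
- by rewrite /arc addrAC [_ + << sing1 c2 >>]addrC.
- by move=> t t01; rewrite sing1_mk1// sing2_mk2 ?e0//=; move: t01 => /andP[? ?]; lra.
- by move=> t t01; rewrite sing1_mk1// sing2_mk2 ?e1//=; move: t01 => /andP[? ?]; lra.
- by move=> t t01; rewrite sing1_mk1// sing2_mk2 ?e2//=; move: t01 => /andP[? ?]; lra.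
Qed.

(** The three faces of a constant 2-simplex are the same constant arc, and their alternating sum
    leaves one copy of it. *)
Lemma homologous_const x : homologous (arc (@continuous_const R X x)) 0.
Proof.
have := @homologous_triangle (fun=> x) (@continuous_const P X x) _ _ _
  (@continuous_const R X x) (@continuous_const R X x) (@continuous_const R X x)
  (fun _ _ => erefl) (fun _ _ => erefl) (fun _ _ => erefl).
move=> /homologousD /(_ (homologousN (homologous_refl (arc (@continuous_const R X x))))).
by rewrite addrK subrr.
Qed.

End Homologous.

Section PlaneArcs.
Context (R : realType) (X : topologicalType).
Notation P := (R * R)%type.
Variables (p : P -> X) (cp : continuous p).

(** Arcs are described by paths of the plane pushed forward by [p], so that homotopies can be
    written as affine formulas upstairs. *)
Definition parc (g : R -> P) (cg : continuous g) : chain R 1 X :=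
  arc (continuousT_comp cg cp).

Lemma parc_const (g : R -> P) (cg : continuous g) z : (forall t, 0 <= t <= 1 -> g t = z) ->
  homologous (parc cg) 0.
Proof.
move=> gz; rewrite (_ : parc cg = arc (@continuous_const R X (p z))).
  exact: homologous_const.
by apply: arc_ext => t /gz ->.
Qed.

Lemma parc_triangle (H : P -> P) (cH : continuous H)
    (g0 g1 g2 : R -> P) (c0 : continuous g0) (c1 : continuous g1) (c2 : continuous g2) :
  (forall t, 0 <= t <= 1 -> g0 t = H (1 - t, t)) ->
  (forall t, 0 <= t <= 1 -> g1 t = H (0, t)) ->
  (forall t, 0 <= t <= 1 -> g2 t = H (t, 0)) ->
  homologous (parc c2 + parc c0) (parc c1).
Proof.
move=> e0 e1 e2; apply: (homologous_triangle (continuousT_comp cH cp)) => t t01.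
- by rewrite e0.
- by rewrite e1.
- by rewrite e2.
Qed.

Definition mix (z w : P) (t : R) : P := (z.1 + t * (w.1 - z.1), z.2 + t * (w.2 - z.2)).

Lemma mix_continuous z w : continuous (mix z w).
Proof. by rewrite /mix; cts. Qed.

(* The linear homotopy is a map on a square, which is cut along its diagonal. *)
Lemma parc_homotopy (g h : R -> P) (cg : continuous g) (ch : continuous h) :
  g 0 = h 0 -> g 1 = h 1 -> homologous (parc cg) (parc ch).
Proof.
move=> gh0 gh1.
pose F (s l : R) := mix (g s) (h s) l.
have F0 s : F s 0 = g s by rewrite /F /mix !mul0r !addr0; case: (g s).
have F1 s : F s 1 = h s by rewrite /F /mix !mul1r !(addrC _ (_ - _)) !subrK; case: (h s).
have Fc s l : g s = h s -> F s l = g s.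
  by rewrite /F /mix => <-; rewrite !subrr !mulr0 !addr0; case: (g s).
have cD : continuous (fun s => F s s) by rewrite /F /mix; cts.
have c1 : continuous (fun z : P => F (z.1 + z.2) z.2) by rewrite /F /mix; cts.
have c2 : continuous (fun z : P => F z.2 (z.1 + z.2)) by rewrite /F /mix; cts.
have cst z : continuous (fun _ : R => z : P) by exact: continuous_const.
have T1 : homologous (parc cg + parc (cst (g 1))) (parc cD).
  apply: (parc_triangle c1) => t _ /=.
  - by rewrite subrK Fc.
  - by rewrite add0r.
  - by rewrite addr0 F0.
have T2 : homologous (parc (cst (g 0)) + parc ch) (parc cD).
  apply: (parc_triangle c2) => t _ /=.
  - by rewrite subrK F1.
  - by rewrite add0r.
  - by rewrite addr0 Fc.
have C1 := @parc_const _ (cst (g 1)) (g 1) (fun _ _ => erefl).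
have C0 := @parc_const _ (cst (g 0)) (g 0) (fun _ _ => erefl).
have := homologousD T1 (homologousN C1); rewrite addrK subr0 => H1.
have := homologousD T2 (homologousN C0); rewrite addrC addKr subr0 => H2.
exact: homologous_trans H1 (homologous_sym H2).
Qed.

Definition pseg z w : chain R 1 X := parc (@mix_continuous z w).

Lemma pseg_trans x y z : homologous (pseg x y + pseg y z) (pseg x z).
Proof.
pose H (u : P) : P := (x.1 + u.1 * (y.1 - x.1) + u.2 * (z.1 - x.1),
                       x.2 + u.1 * (y.2 - x.2) + u.2 * (z.2 - x.2)).
have cH : continuous H by rewrite /H; cts.
by apply: (parc_triangle cH) => t _; rewrite /H /mix /=; congr pair; ring.
Qed.

Lemma pseg_refl z : homologous (pseg z z) 0.
Proof.
apply: (@parc_const _ _ z) => t _.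
by rewrite /mix !subrr !mulr0 !addr0; case: z.
Qed.

Lemma pseg_sym z w : homologous (pseg z w) (- pseg w z).
Proof.
have := homologousD (homologous_trans (pseg_trans z w z) (pseg_refl z))
  (homologousN (homologous_refl (pseg w z))).
by rewrite addrK sub0r.
Qed.

End PlaneArcs.

(** * Winding number on the first homology of the circle *)

Section FirstHomology.
Context (R : realType).
Implicit Types (X Y : topologicalType).

Lemma H1_class_is_additive X : additive (@H1_class R X).
Proof.
move=> z z'; rewrite /H1_class.
apply: etrans (@Quotient.pi_add _ (@is_boundary R X) z (- z')) _.
by congr (_ + _); exact: Quotient.pi_opp.
Qed.

HB.instance Definition _ X := GRing.isAdditive.Build
  (cycle R X) (H1 R X) (@H1_class R X) (@H1_class_is_additive X).

Lemma H1_classK X (u : H1 R X) : exists z : cycle R X, u = H1_class z.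
Proof. by exists (repr (u : Quotient.quot (@is_boundary R X))); rewrite -[LHS]reprK. Qed.

Lemma loop_subproof X (g : R -> X) (cg : continuous g) : g 0 = g 1 ->
  arc cg \in @is_cycle R X.
Proof.
move=> g01; rewrite inE boundary1 !sing1_mk1 ?lexx ?ler01//= g01 subrr//.
Qed.

Definition loop X (g : R -> X) (cg : continuous g) (g01 : g 0 = g 1) : cycle R X :=
  Cycle (loop_subproof cg g01).

Lemma chain_map1 X Y n (h : continuousType X Y) (s : singular R n X) :
  chain_map h << s >> = << (h \o s : singular R n Y) >>.
Proof. by rewrite /chain_map liftU scale1r. Qed.

Lemma chain_ind X n (Q : chain R n X -> Prop) :
  Q 0 -> (forall a b, Q a -> Q b -> Q (a + b)) -> (forall a, Q a -> Q (- a)) ->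
  (forall s, Q << s >>) -> forall c, Q c.
Proof.
move=> Q0 QD QN Q1 c.
have QM a (k : nat) : Q a -> Q (a *+ k).
  by move=> Qa; elim: k => [|k IH]; rewrite ?mulr0n// mulrS; exact: QD.
rewrite -(freeg_sumE c); apply: (big_ind Q) => // s _.
rewrite -[coeff _ _]intz -freegU_mulz; case: (coeff _ _) => k; first by apply: QM.
by rewrite NegzE mulrNz; apply: QN; exact: QM.
Qed.

Lemma H1_map_comp X Y (Z : topologicalType) (h : continuousType X Y) (k : continuousType Y Z)
    (hk : continuousType X Z) (u : H1 R X) : (forall x, hk x = k (h x)) ->
  H1_map k (H1_map h u) = H1_map hk u :> H1 R Z.
Proof.
move=> hkE; have [z ->] := H1_classK u; rewrite !H1_mapE.
congr H1_class; apply: val_inj => /=.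
elim/chain_ind: (cycle_chain z) => [|a b Qa Qb|a Qa|s]; rewrite ?raddf0//.
- by rewrite !raddfD/= Qa Qb.
- by rewrite !raddfN/= Qa.
- by rewrite !chain_map1; congr << _ >>; apply/continuousEP => t /=; rewrite hkE.
Qed.

Lemma H1_map_loop X Y (h : continuousType X Y) (g : R -> X) (cg : continuous g)
    (g01 : g 0 = g 1) (hg : R -> Y) (chg : continuous hg) (hg01 : hg 0 = hg 1) :
  (forall t, 0 <= t <= 1 -> hg t = h (g t)) ->
  H1_map h (H1_class (loop cg g01)) = H1_class (loop chg hg01).
Proof.
move=> hgE; rewrite H1_mapE; congr H1_class; apply: val_inj => /=.
rewrite /arc chain_map1; congr << _ >>; apply/continuousEP => t /=.
by apply/esym/hgE; have [] := coord_simplex1 t.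
Qed.

(* [zmodule R] is [R] as a Z-module, the kind of target [fglift] expects.
   The value does not depend on the lift [g], by [wind1E]. *)
Definition wind1 (s : singular R 1 (circle R)) : zmodule R :=
  get [set x : R | exists g : R -> R, [/\ continuous g,
    forall t, 0 <= t <= 1 -> eR (g t) = s (mk1 t) & x = g 1 - g 0]].

Lemma wind1E (s : singular R 1 (circle R)) (g : R -> R) : continuous g ->
  (forall t, 0 <= t <= 1 -> eR (g t) = s (mk1 t)) -> wind1 s = g 1 - g 0 :> R.
Proof.
move=> cg gs; rewrite /wind1; apply: get_unique; first by exists g.
move=> _ [h [ch hs ->]].
have [|k kE] := @eR_eq R (g 0) (h 0); first by rewrite gs ?hs// lexx ler01.
have cgk : continuous (fun t => g t + k%:~R) by cts.
have gh t : 0 <= t <= 1 -> h t = g t + k%:~R.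
  move=> t01.
  apply: (@lift_unique _ _ (@eR R) R `[0, 1]%classic h (fun t => g t + k%:~R) 0 _ _ _ _ _ _ _ _ t) => //;
    first [exact: (@R_hausdorff R) | exact: (@eR_locally_injective R) | exact: segment_connected
    | by move=> x; rewrite /= in_itv/= => x01; rewrite eR_int hs// gs
    | by rewrite /= in_itv/= ?lexx ?ler01//].
by rewrite !gh ?lexx ?ler01//; ring.
Qed.

Definition wind : chain R 1 (circle R) -> zmodule R := fglift wind1.

Lemma wind_is_additive : additive wind.
Proof. exact: lift_is_additive. Qed.

HB.instance Definition _ := GRing.isAdditive.Build _ _ wind wind_is_additive.

Lemma wind_simplex s : wind << s >> = wind1 s.
Proof. by rewrite /wind liftU scale1r. Qed.

(** A 2-simplex, extended to the plane through [mk2], lifts through [eR]. The windings of its edges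
    are then differences of the lift at the vertices, and they cancel. *)
Lemma wind_boundary (e : chain R 2 (circle R)) : wind (boundary e) = 0.
Proof.
elim/chain_ind: e => [|a b Qa Qb|a Qa|s]; rewrite ?raddf0//.
- by rewrite !raddfD/= Qa Qb addr0.
- by rewrite !raddfN/= Qa oppr0.
pose q (z : R * R) := s (mk2 z).
have cq : continuous q.
  exact: (continuousT_comp (@mk2_continuous R) (@cts_fun _ _ s)).
have [b0 b0q] := eR_surj (q (0, 0)).
have [g [cg _ gq]] := eR_lift cq b0q.
have c0 : continuous (fun t : R => (1 - t, t)) by cts.
have c1 : continuous (fun t : R => ((0, t) : R * R)) by cts.
have c2 : continuous (fun t : R => ((t, 0) : R * R)) by cts.
have d0 := continuousT_comp c0 cq; have d1 := continuousT_comp c1 cq.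
have d2 := continuousT_comp c2 cq.
rewrite (@boundary2 _ _ _ (sing1 d0) (sing1 d1) (sing1 d2)).
- have e0 := continuousT_comp c0 cg; have e1 := continuousT_comp c1 cg.
  have e2 := continuousT_comp c2 cg.
  rewrite raddfD raddfB /= !wind_simplex.
  rewrite (wind1E e0); last by move=> t t01; rewrite gq sing1_mk1.
  rewrite (wind1E e1); last by move=> t t01; rewrite gq sing1_mk1.
  rewrite (wind1E e2); last by move=> t t01; rewrite gq sing1_mk1.
  by rewrite /= subrr subr0 -[RHS]/(0 : R); ring.
- by move=> t t01; rewrite sing1_mk1.
- by move=> t t01; rewrite sing1_mk1.
- by move=> t t01; rewrite sing1_mk1.
Qed.

Definition windH (u : H1 R (circle R)) : R :=
  wind (cycle_chain (repr (u : Quotient.quot (@is_boundary R (circle R))))).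

Lemma windH_class z : windH (H1_class z) = wind (cycle_chain z).
Proof.
have /H1_class_eq[b bz] : H1_class (repr (H1_class z)) = H1_class z by exact: reprK.
apply/eqP; rewrite -subr_eq0 -[X in _ == X](wind_boundary b) bz raddfB.
by [].
Qed.

Lemma windHMz u k : windH (u *~ k) = windH u *~ k.
Proof.
have [z ->] := H1_classK u; rewrite -raddfMz !windH_class.
rewrite -[RHS](raddfMz wind k (cycle_chain z)); congr wind.
exact: (raddfMz (\val : cycle R (circle R) -> _) k z).
Qed.

Lemma windH_loop (q : R -> circle R) (cq : continuous q) (q01 : q 0 = q 1) (g : R -> R) :
  continuous g -> (forall t, 0 <= t <= 1 -> eR (g t) = q t) ->
  windH (H1_class (loop cq q01)) = g 1 - g 0.
Proof.
move=> cg gq; rewrite windH_class wind_simplex (wind1E cg)// => t t01.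
by rewrite sing1_mk1// gq.
Qed.

End FirstHomology.

(** * Generation of the first homology of the annulus by the core circle *)

Section AnnulusHomology.
Context (R : realType).
Notation P := (R * R)%type.
Notation A := (annulus R).
Notation hom := (@homologous R A).

Definition origin : P := (0, 0).
(** A pointwise choice of preimage, with no continuity claimed: it is used only to name a lift of
    individual points. *)
Definition sec (p : A) : P := projT1 (cid (cov_surj p)).

Lemma secK p : cov (sec p) = p.
Proof. by rewrite /sec; case: cid. Qed.

Notation aseg := (pseg (@cov_continuous R)).

Lemma aseg_shift k z w : aseg (shift k z) (shift k w) = aseg z w.
Proof.
apply: arc_ext => t _; rewrite -[RHS](cov_shift k); congr cov.
by rewrite /mix /shift /=; congr pair; ring.
Qed.

Definition core : chain R 1 A := aseg origin (shift 1 origin).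

Lemma aseg_core k : hom (aseg origin (shift k origin)) (core *~ k).
Proof.
have nat_case (n : nat) : hom (aseg origin (shift n origin)) (core *+ n).
  elim: n => [|n IH]; first by rewrite shift0 mulr0n; exact: pseg_refl.
  rewrite mulrSr; apply: homologous_trans (homologous_sym (pseg_trans _ origin (shift n origin) _)) _.
  apply: homologousD => //; rewrite (_ : shift n.+1 origin = shift n (shift 1 origin)).
    by rewrite aseg_shift; exact: homologous_refl.
  by rewrite shiftD; congr shift; lia.
case: k => n; first exact: nat_case.
rewrite NegzE mulrNz; apply: homologous_trans (pseg_sym _ _ _) _.
apply: homologousN; rewrite -(aseg_shift n.+1) shiftD addNr shift0; exact: nat_case.
Qed.

(** A lift of [s] starting at the chosen preimage of its origin ends at a translate by some [k] of
    the chosen preimage of its end. It is homologous to a straight segment, which is rerouted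
    through [origin] and [shift k origin]. *)
Lemma simplex_core (s : singular R 1 A) : exists k : int,
  hom << s >> (core *~ k + (aseg origin (sec (s (mk1 1))) - aseg origin (sec (s (mk1 0))))).
Proof.
have c1 : continuous (fun z : P => mk1 z.1).
  exact: (continuousT_comp (@continuous_fst _ _) (@mk1_continuous R)).
have cq : continuous (fun z : P => s (mk1 z.1)).
  exact: (continuousT_comp c1 (@cts_fun _ _ s)).
have [|g [cg g0 gq]] := @cov_lift R _ origin (sec (s (mk1 0))) cq; first exact: secK.
have ci : continuous (fun t : R => ((t, 0) : P)) by cts.
have ch := continuousT_comp ci cg.
have sE : << s >> = parc (@cov_continuous R) ch :> chain R 1 A.
  congr << _ >>; apply/continuousEP => t.
  by apply: etrans (esym (gq _)); rewrite /= mk1K.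
have [|k kE] := @cov_eq R (sec (s (mk1 1))) (g (1, 0)); first by rewrite secK gq.
exists k; rewrite sE.
apply: homologous_trans (parc_homotopy _ ch (@mix_continuous R (g origin) (g (1, 0))) _ _) _.
- by rewrite /mix !mul0r !addr0; case: (g _).
- by rewrite /mix !mul1r !(addrC _ (_ - _)) !subrK; case: (g _).
rewrite g0 kE -/(aseg _ _).
apply: homologous_trans (homologous_sym (pseg_trans _ _ origin _)) _.
rewrite addrA [X in hom _ X]addrC; apply: homologousD; first exact: pseg_sym.
apply: homologous_trans (homologous_sym (pseg_trans _ origin (shift k origin) _)) _.
rewrite aseg_shift; apply: homologousD; [exact: aseg_core|exact: homologous_refl].
Qed.

Lemma mk0_subproof : (\row_(i < 1) 1) \in simplex R 0.
Proof.
apply/mem_set; split => [i|]; first by rewrite mxE.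
by rewrite big_ord_recl big_ord0 mxE addr0.
Qed.

Definition mk0 : simplex R 0 := exist (fun t => t \in simplex R 0) _ mk0_subproof.

Definition spoke : chain R 0 A -> chain R 1 A :=
  fglift (fun s : singular R 0 A => aseg origin (sec (s mk0))).

Lemma spoke_is_additive : additive spoke.
Proof. exact: lift_is_additive. Qed.

HB.instance Definition _ := GRing.isAdditive.Build _ _ spoke spoke_is_additive.

(* Closing up every simplex along the spokes of its end points turns it into a
   multiple of the core. *)
Lemma chain_core (c : chain R 1 A) : exists k : int, hom c (core *~ k + spoke (boundary c)).
Proof.
elim/chain_ind: c => [|a b [k ka] [l lb]|a [k ka]|s].
- by exists 0; rewrite mulr0z !raddf0 addr0; exact: homologous_refl.
- exists (k + l); rewrite mulrzDr !(raddfD, raddfD (@boundary R 0 A))/= addrACA; exact: homologousD.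
- by exists (- k); rewrite mulrNz !raddfN/= -opprD; exact: homologousN.
- have [k ks] := simplex_core s; exists k.
  by rewrite boundary1 raddfB/= /spoke !liftU !scale1r.
Qed.

Lemma core_loop_subproof : cov (mix origin (shift 1 origin) 0) = cov (mix origin (shift 1 origin) 1).
Proof.
rewrite -(cov_shift 1 (mix _ _ 0)); congr cov.
by rewrite /mix /shift /=; congr pair; ring.
Qed.

Definition core_class : H1 R A := H1_class (loop
  (continuousT_comp (@mix_continuous R origin (shift 1 origin)) (@cov_continuous R)) core_loop_subproof).

Lemma H1_core u : exists k : int, u = core_class *~ k.
Proof.
have [z ->] := H1_classK u; have [k [b bE]] := chain_core (cycle_chain z).
exists k; rewrite /core_class -raddfMz; apply/H1_class_eq; exists b.
have z0 : boundary (cycle_chain z) = 0.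
  by case: (z) => c /= cc; apply/eqP; move: cc; rewrite inE.
rewrite bE z0 raddf0 addr0; congr (_ - _).
by apply: esym; exact: (raddfMz (\val : cycle R A -> _) k).
Qed.

Definition angle_map : continuousType A (circle R) := mkcts (@angle_continuous R).

Definition winding (u : H1 R A) : R := windH (H1_map angle_map u).

Lemma windingMz u k : winding (u *~ k) = winding u *~ k.
Proof. by rewrite /winding raddfMz windHMz. Qed.

Lemma winding_loop (q : R -> A) (cq : continuous q) (q01 : q 0 = q 1) (g : R -> P) :
  continuous g -> (forall t, 0 <= t <= 1 -> cov (g t) = q t) ->
  winding (H1_class (loop cq q01)) = (g 1).2 - (g 0).2.
Proof.
move=> cg gq; have cq2 : continuous (fun t => (q t).2 : circle R).
  exact: (continuousT_comp cq (@angle_continuous R)).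
have q201 : (q 0).2 = (q 1).2 by rewrite q01.
rewrite /winding (@H1_map_loop _ _ _ _ _ cq q01 _ cq2 q201)//.
have cg2 : continuous (fun t => (g t).2) by cts.
by rewrite (windH_loop cq2 q201 cg2)// => t /gq <-.
Qed.

Lemma winding_core : winding core_class = 1.
Proof.
rewrite /core_class (winding_loop _ _ (@mix_continuous R origin (shift 1 origin)))//.
by rewrite /mix /shift /=; ring.
Qed.

Lemma winding_inj u v : winding u = winding v -> u = v.
Proof.
have [k ->] := H1_core u; have [l ->] := H1_core v.
by rewrite !windingMz winding_core => /intr_inj ->.
Qed.

Lemma winding1_generates c u : winding c = 1 -> exists k : int, u = c *~ k.
Proof.
move=> c1; have [k kE] := H1_core u; exists k; apply: winding_inj.
by rewrite kE !windingMz c1 winding_core.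
Qed.

End AnnulusHomology.

(** * Lifting the covering and the connector *)

Section LiftOfCovering.
Context (R : realType).
Notation P := (R * R)%type.
Notation A := (annulus R).

Lemma connected_plane : connected [set: P].
Proof. by apply: (@pconn_connected _ _ (0, 0)) => y _; exact: pconnT. Qed.

Lemma cov_lift_unique (g1 g2 : P -> P) z0 : continuous g1 -> continuous g2 ->
  (forall z, cov (g1 z) = cov (g2 z)) -> g1 z0 = g2 z0 -> g1 =1 g2.
Proof.
move=> c1 c2 g12 g0 z.
have e1 : (g1 z).1 = (g2 z).1.
  by have /(congr1 (@unsquash R)) := congr1 (@height R) (g12 z); rewrite !height_cov !squashK.
have e2 : (g1 z).2 = (g2 z).2.
  have d1 : continuous (fun z => (g1 z).2) by cts.
  have d2 : continuous (fun z => (g2 z).2) by cts.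
  apply: (@lift_unique _ _ (@eR R) P setT _ _ z0 _ _ _ d1 d2 _ _ _ z) => //;
    first [exact: (@R_hausdorff R) | exact: (@eR_locally_injective R) | exact: connected_plane
      | by move=> x _; exact: (congr1 (fun p : A => p.2) (g12 x)) | by rewrite g0].
by case: (g1 z) (g2 z) e1 e2 => a b [c e] /= -> ->.
Qed.

(** As [f] is a covering, [cov] lifts through [f] to a map [g0] on the plane, and a lift of [g0]
    through [cov] is the inverse of [F], both compositions being identified by uniqueness of
    lifts. *)
Lemma covering_lift_homeo (f : continuousType A A) (d : int) :
  covering_map f -> degree f d -> exists F G : P -> P,
  [/\ continuous F /\ continuous G, cancel F G, cancel G F,
      forall z, cov (F z) = f (cov z) & forall k z, F (shift k z) = shift (d * k) (F z)].
Proof.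
move=> fcov fdeg.
have cf : continuous f by exact: cts_fun.
have cfc : continuous (fun z => f (cov z)) by exact: (continuousT_comp (@cov_continuous R) cf).
have [F [cF _ Ff]] := @cov_lift R _ (origin R) (sec (f (cov (origin R)))) cfc (secK _).
have [g0 [cg0 g00 fg0]] := lift_plane (@annulus_hausdorff R) (covering_local_sections fcov)
  (covering_locally_injective fcov) (@cov_continuous R) (esym (Ff (origin R))).
have [G [cG G0 Gg0]] := @cov_lift R _ (F (origin R)) (origin R) cg0 (esym g00).
have g0F z : g0 (F z) = cov z.
  have cgF := continuousT_comp cF cg0.
  apply: (@lift_unique _ _ f P setT _ _ (origin R) _ _ _ cgF (@cov_continuous R) _ _ _ z) => //;
    first [exact: (@annulus_hausdorff R) | exact: covering_locally_injective
      | exact: connected_plane | by move=> x _; rewrite fg0 Ff].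
have FK : cancel F G.
  have cGF := continuousT_comp cF cG.
  by apply: (cov_lift_unique cGF (@continuous_id P) _ G0) => z; rewrite Gg0 g0F.
have GK : cancel G F.
  have cFG := continuousT_comp cG cF.
  apply: (cov_lift_unique (z0 := F (origin R)) cFG (@continuous_id P)); last by rewrite FK.
  by move=> z; rewrite Ff Gg0 fg0.
have [|k kE] := @cov_eq R (F (origin R)) (F (shift 1 (origin R))); first by rewrite !Ff cov_shift.
have F1 z : F (shift 1 z) = shift k (F z).
  have c1 := continuousT_comp (@shift_continuous R 1) cF.
  have c2 := continuousT_comp cF (@shift_continuous R k).
  by apply: (cov_lift_unique c1 c2 _ kE) => x; rewrite cov_shift !Ff cov_shift.
(* The image under [f] of the core loop is lifted by the image under [F] of a segment from [origin]
   to its translate; its winding number is [k] on one hand and [d] by the degree on the other. *)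
have kd : k = d.
  have c1 := continuousT_comp (@mix_continuous R (origin R) (shift 1 (origin R))) (@cov_continuous R).
  have c2 := continuousT_comp c1 cf; have c3 := continuousT_comp (@mix_continuous R (origin R) (shift 1 (origin R))) cF.
  have e01 : f (cov (mix (origin R) (shift 1 (origin R)) 0)) = f (cov (mix (origin R) (shift 1 (origin R)) 1)).
    by rewrite core_loop_subproof.
  have := congr1 (@winding R) (fdeg (core_class R)).
  rewrite windingMz winding_core /core_class (@H1_map_loop _ _ _ _ _ _ _ _ c2 e01)//.
  rewrite (winding_loop _ _ c3)//.
  have -> : mix (origin R) (shift 1 (origin R)) 1 = shift 1 (origin R) by rewrite /mix /shift /=; congr pair; ring.
  have -> : mix (origin R) (shift 1 (origin R)) 0 = origin R by rewrite /mix /shift /=; congr pair; ring.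
  by rewrite F1 /= addrC addKr => /intr_inj.
rewrite kd in F1; exists F, G; split => //.
have nat_case (n : nat) z : F (shift n z) = shift (d * n) (F z).
  elim: n => [|n IH]; first by rewrite mulr0 !shift0.
  rewrite (_ : shift n.+1 z = shift 1 (shift n z)); last by rewrite shiftD; congr shift; lia.
  by rewrite F1 IH shiftD; congr shift; lia.
case=> n z; first exact: nat_case.
have := nat_case n.+1 (shift (Negz n) z); rewrite shiftD.
rewrite (_ : Negz n + n.+1 = 0) ?shift0; last by lia.
by move=> ->; rewrite shiftD (_ : _ + _ = 0) ?shift0//; lia.
Qed.

End LiftOfCovering.

Lemma continuous_at_pair (X Y Z : topologicalType) (f : X -> Y) (g : X -> Z) x :
  {for x, continuous f} -> {for x, continuous g} -> {for x, continuous (fun x => (f x, g x))}.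
Proof. by move=> cf cg; apply: cvg_pair; [exact: cf|exact: cg]. Qed.

(** * Lifting a trivial connector *)

Section LiftOfConnector.
Context (R : realType).
Notation P := (R * R)%type.
Notation A := (annulus R).

Lemma cov_section (z : P) : exists (s : A -> P) (U : set A),
  [/\ open U, U (cov z), s (cov z) = z, forall p, U p -> cov (s p) = p &
      forall p, U p -> {for p, continuous s}].
Proof.
have [s [s0 se sc]] := @circle_section R _ z.2 erefl.
pose U := [set p : A | 0 < cX (p.2 : circle R) * cX (cov z).2 + cY (p.2 : circle R) * cY (cov z).2].
have cXp : continuous (fun p : A => cX (p.2 : circle R)).
  exact: (continuousT_comp (@angle_continuous R) (@cX_continuous R)).
have cYp : continuous (fun p : A => cY (p.2 : circle R)).
  exact: (continuousT_comp (@angle_continuous R) (@cY_continuous R)).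
exists (fun p => (unsquash (height p), s (p.2 : circle R))), U; split.
- apply: open_pos; apply: continuous_add2; apply: continuous_mul2 => //; exact: continuous_const.
- by rewrite /U /= -!expr2 circle_norm.
- by rewrite height_cov squashK s0; case: (z).
- move=> p Up; apply: annulus_inj; last exact: se.
  by rewrite height_cov/= unsquash_itvK// height_itv.
- move=> p Up; apply: (@continuous_at_pair A _ _ (fun p : A => unsquash (height p))
      (fun p : A => s (p.2 : circle R))).
    have : continuous (fun p : A => unsquash (height p)).
      by apply: continuous_unsquash; [exact: height_itv|exact: height_continuous].
    by move=> /(_ p).
  apply: (@continuous_comp _ _ _ (fun p : A => p.2 : circle R) s); first exact: angle_continuous.
  exact: sc.
Qed.

Lemma cov_open (G : set P) : open G -> open (@cov R @` G).
Proof.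
move=> oG; rewrite openE => _ [z Gz <-].
have [s [U [oU Uz sz Us cs]]] := cov_section z.
have h1 : nbhs (cov z) (s @^-1` G) by apply: (cs _ Uz); rewrite sz; exact: open_nbhs_nbhs.
have h2 : nbhs (cov z) U by exact: open_nbhs_nbhs.
by apply: filterS2 h1 h2 => p Gp Up; exists (s p) => //; exact: Us.
Qed.

Lemma squashN a : squash (- a) = 1 - squash a :> R.
Proof. by rewrite /squash normrN mulNr; field. Qed.

Lemma squash_small (M : R) : 0 < M -> exists2 r : R, 0 < r &
  forall a, (squash a < r -> a <= - M) /\ (1 - r < squash a -> M <= a).
Proof.
(* This is [squash (- M)]. *)
move=> M0; exists (2 * (1 + M))^-1; first by rewrite invr_gt0; lra.
have H a : squash a < (2 * (1 + M))^-1 -> a <= - M.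
  move=> h; rewrite leNgt; apply/negP => aM; move: h; apply/negP; rewrite -leNgt.
  have [a0|a0] := leP 0 a.
    have : 0 <= a / (1 + `|a|) by rewrite divr_ge0// addr_ge0.
    have : (2 * (1 + M))^-1 <= 2^-1 by rewrite lef_pV2 ?posrE; lra.
    by rewrite /squash; lra.
  rewrite /squash (ltr0_norm a0).
  have -> : (1 + a / (1 - a)) / 2 = (2 * (1 - a))^-1 by field; apply/eqP; lra.
  by rewrite lef_pV2 ?posrE; lra.
move=> a; split; first exact: H.
move=> h; rewrite -lerN2; apply: H; rewrite squashN; lra.
Qed.

Variables (C U : set A).
Hypotheses (conC : connected C) (cloC : closed C)
  (endC : forall r : R, 0 < r -> exists p q, [/\ C p, C q, height p < r & 1 - r < height q])
  (oU : open U) (CU : C `<=` U) (nU : ~ essential_open U).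

Let W : set P := @cov R @^-1` U.

Lemma open_W : open W.
Proof. by apply: open_comp => // z _; exact: cov_continuous. Qed.

Lemma W_shift k z : W z -> W (shift k z).
Proof. by rewrite /W /= cov_shift. Qed.

Lemma pconn_W_shift k z w : pconn W z w -> pconn W (shift k z) (shift k w).
Proof. by apply: pconn_map; [exact: shift_continuous|exact: W_shift]. Qed.

(** Such a path would project to a loop in [U] of winding number 1, and its class would generate the
    homology of the annulus. *)
Lemma no_unit_path z : ~ pconn W z (shift 1 z).
Proof.
move=> [g [cg g0 g1 gW]].
have cgU : continuous (fun t => exist (fun p => p \in U) (cov (g t)) (mem_set (gW t)) : U).
  apply: continuous_comp_initial; exact: (continuousT_comp cg (@cov_continuous R)).
have gU01 : exist (fun p => p \in U) (cov (g 0)) (mem_set (gW 0)) =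
    exist (fun p => p \in U) (cov (g 1)) (mem_set (gW 1)) :> U.
  by apply: val_inj; rewrite /= g0// g1// cov_shift.
have g01 : cov (g 0) = cov (g 1) by rewrite g0// g1// cov_shift.
apply: nU => u.
have [|k kE] := @winding1_generates R
  (H1_class (loop (continuousT_comp cg (@cov_continuous R)) g01)) u.
  by rewrite (winding_loop _ _ cg)// (g0 0)// (g1 1)//= addrC addKr.
exists (H1_class (loop cgU gU01) *~ k).
by rewrite raddfMz/= (@H1_map_loop _ _ _ _ _ _ _ _ (continuousT_comp cg (@cov_continuous R)) g01).
Qed.

Variable z0 : P.
Hypothesis Cz0 : C (cov z0).

Let V : set P := pconn W z0.

Lemma open_V : open V. Proof. exact: open_pconn open_W. Qed.

(** The points of [W] with no translate in [V] form an open set [Z]. The images of [V] and [Z] are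
    open, disjoint and cover the connected set [C]. *)
Lemma C_sub_V : C `<=` @cov R @` V.
Proof.
pose Z := [set z | W z /\ ~ exists j, V (shift j z)].
have oZ : open Z.
  rewrite openE => z [Wz nz].
  have : nbhs z (pconn W z).
    by apply: open_nbhs_nbhs; split; [exact: open_pconn open_W|exact: pconn_refl].
  apply: filterS => y zy; split; first exact: pconn_r zy.
  move=> [j Vy]; apply: nz; exists j; apply: (pconn_trans Vy).
  by apply: pconn_sym; exact: pconn_W_shift.
have VZ z y : V z -> Z y -> cov z = cov y -> False.
  move=> Vz [Wy ny] /cov_eq[k kE]; apply: ny; exists (- k).
  by rewrite kE shiftD addrN shift0.
have CVZ p : C p -> (@cov R @` V) p \/ (@cov R @` Z) p.
  move=> Cp; have Wp : W (sec p) by rewrite /W /= secK; exact: CU.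
  have [[j Vj]|nj] := pselect (exists j, V (shift j (sec p))).
    by left; exists (shift j (sec p)) => //; rewrite cov_shift secK.
  by right; exists (sec p); rewrite ?secK.
suff E : C `&` @cov R @` V = C by rewrite -E => p [].
apply: conC.
- exists (cov z0); split=> //; exists z0 => //; apply: pconn_refl; exact: CU.
- by exists (@cov R @` V) => //; exact: cov_open open_V.
- exists (~` (@cov R @` Z)); first by rewrite closedC; exact: cov_open.
  apply/seteqP; split=> p [Cp].
    by move=> [z Vz zp]; split=> // -[y Zy yp]; apply: (VZ z y) => //; rewrite zp yp.
  by move=> nZ; split=> //; case: (CVZ p Cp).
Qed.

Lemma V_ends (M : R) : 0 < M -> exists z w,
  [/\ V z /\ C (cov z), V w /\ C (cov w), z.1 <= - M & M <= w.1].
Proof.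
move=> M0; have [r r0 rP] := squash_small M0.
have [p [q [Cp Cq pr qr]]] := endC r0.
have [z Vz zp] := C_sub_V Cp; have [w Vw wq] := C_sub_V Cq.
exists z, w; split; rewrite ?zp ?wq//.
  by apply: (rP z.1).1; rewrite -height_cov zp.
by apply: (rP w.1).2; rewrite -height_cov wq.
Qed.

(* A path from [z] to [shift j z] in [V], continued periodically, crosses the
   part of [shift 1 V] that joins the ends of the strip: [V] contains some [y] and
   [shift 1 y], against [no_unit_path]. *)
Lemma V_disjoint j z : V z -> V (shift j z) -> j = 0.
Proof.
wlog j0 : j z / 0 < j => [H Vz Vj|].
  have [j0|j0|//] := ltgtP 0 j; first exact: H j0 Vz Vj.
  suff : - j = 0 by move/eqP; rewrite oppr_eq0 => /eqP.
  apply: (H (- j) (shift j z)) => //; first by rewrite oppr_gt0.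
  by rewrite shiftD addrN shift0.
move=> Vz Vj; exfalso.
have z0j : pconn W z0 (shift j z0).
  by apply: (pconn_trans Vj); apply: pconn_W_shift; exact: pconn_sym.
have z0k (k : int) : pconn W z0 (shift (k * j) z0).
  have nat_case (n : nat) : pconn W z0 (shift (n%:Z * j) z0).
    elim: n => [|n IH]; first by rewrite mul0r shift0; exact: pconn_refl (pconn_l Vz).
    apply: (pconn_trans z0j); have := pconn_W_shift j IH; rewrite shiftD.
    by have -> : n%:Z * j + j = n.+1%:Z * j by lia.
  case: k => n; first exact: nat_case.
  have := pconn_W_shift (Negz n * j) (nat_case n.+1); rewrite shiftD.
  have -> : n.+1%:Z * j + Negz n * j = 0 by lia.
  by rewrite shift0; exact: pconn_sym.
have Vk k y : V y -> V (shift (k * j) y).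
  by move=> Vy; apply: (pconn_trans (z0k k)); exact: pconn_W_shift.
(* The path stays in the component [V], not just in [W], and its horizontal extent [M] tells how far
   the ends of the crossing path must be. *)
have [g [cg g0 g1 gV]] := pconn_self (pconn_trans (pconn_sym Vz) Vj).
have cg1 : continuous (fun t => (g t).1) by cts.
have [M gM] : exists M, forall t, - M <= (g t).1 <= M.
  apply: path_bounded => // t.
  have [t0|t0] := leP t 0; first by rewrite clamp_le0// !g0.
  have [t1|t1] := leP 1 t; first by rewrite clamp_ge1// !g1.
  by rewrite clamp_id// !ltW.
have M1 : 0 < `|M| + 1 by rewrite ltr_pwDr.
pose G := [set y | V y /\ - (`|M| + 1) <= y.1 <= `|M| + 1].
have Gj k : pconn G (shift (k * j) z) (shift ((k + 1) * j) z).
  have : pconn G z (shift j z).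
    exists g; split => // t; split; first exact: (pconn_trans Vz (gV t)).
    by have /andP[? ?] := gM t; have ? := ler_norm M; apply/andP; split; lra.
  move=> /(@pconn_map _ G G (shift (k * j))) h.
  have -> : shift ((k + 1) * j) z = shift (k * j) (shift j z) by rewrite shiftD; congr shift; lia.
  by apply: h; [exact: shift_continuous|move=> y [Vy ym]; split => //; exact: Vk].
have Gn k (n : nat) : pconn G (shift (k * j) z) (shift ((k + n) * j) z).
  elim: n => [|n IH].
    by rewrite addr0; exact: pconn_refl (pconn_l (Gj k)).
  apply: (pconn_trans IH); have -> : k + n.+1 = k + n + 1 by lia.
  exact: Gj.
have [x [w [[Vx _] [Vw _] xM wM]]] := V_ends M1.
pose K := shift (-1) @^-1` V.
have Kxw : pconn K (shift 1 x) (shift 1 w).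
  have := pconn_self (pconn_trans (pconn_sym Vx) Vw).
  apply: pconn_map; first exact: shift_continuous.
  by move=> y xy; rewrite /K /= shiftD addrN shift0; exact: (pconn_trans Vx xy).
have [|T||||y [[Vy _] Ky]] := @pconn_cross R G K (`|M| + 1) (shift 1 x) (shift 1 w) => //.
- by move=> y [].
(* Each period has height [j >= 1], so [n] periods below and above [z] go beyond [- T] and [T]. *)
- pose n := Num.bound (`|z.2| + `|T|).
  have nT : `|z.2| + `|T| < n%:R by apply: archi_boundP; rewrite addr_ge0.
  have j1 : (1 : R) <= j%:~R by rewrite -[1]/(1%:~R) ler_int; lia.
  have nj : (n%:R : R) <= n%:R * j%:~R by rewrite ler_peMr.
  have ? := ler_norm T; have ? := ler_norm z.2; have := ler_norm (- z.2); rewrite normrN => ?.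
  exists (shift (- n%:Z * j) z), (shift ((- n%:Z + (n + n)%N) * j) z); split; last exact: Gn.
    by rewrite /= intrM mulrNz mulNr -pmulrn; lra.
  rewrite PoszD addKr.
  by rewrite /= intrM -pmulrn; lra.
- apply: (@no_unit_path (shift (-1) y)).
  have -> : shift 1 (shift (-1) y) = y by rewrite shiftD addNr shift0.
  exact: (pconn_trans (pconn_sym Ky) Vy).
Qed.

(** The lift is the part of the preimage of [C] in [V]. Translates of [V] are open and pairwise
    disjoint: a limit point lying over [C] cannot be in another translate, which gives closedness,
    and near any point at most one translate of the lift is present. *)
Lemma connector_lift_aux : exists C0 : set P,
  [/\ closed C0 /\ connected C0, forall j z, C0 z -> C0 (shift j z) -> j = 0,
      forall z, C (cov z) <-> exists k, C0 (shift k z),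
      forall z : R * R, exists k, \forall y \near z, forall j, C0 (shift j y) -> j = k
    & forall M, exists z w, [/\ C0 z, C0 w, z.1 <= - M & M <= w.1]].
Proof.
pose C0 := V `&` @cov R @^-1` C.
have Vshift z : C (cov z) -> exists k, V (shift k z).
  by move=> /C_sub_V[y Vy] /esym/cov_eq[k yE]; exists k; rewrite -yE.
have openVk k : open (shift k @^-1` V).
  by apply: open_comp; [move=> z _; exact: shift_continuous|exact: open_V].
have nclos z : ~ C (cov z) -> nbhs z (@cov R @^-1` (~` C)).
  move=> nC; apply: cov_continuous; apply: open_nbhs_nbhs; split=> //.
  exact: closed_openC.
exists C0; split.
- split.
    rewrite -[X in closed X]setCK closedC openE => z nz.
    have [Cz|nCz] := pselect (C (cov z)); last first.
      by apply: filterS (nclos z nCz) => y nCy [].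
    have [k Vkz] := Vshift z Cz.
    have k0 : k != 0 by apply/eqP => k0; apply: nz; split=> //; rewrite k0 shift0 in Vkz.
    have : nbhs z (shift k @^-1` V) by apply: open_nbhs_nbhs.
    by apply: filterS => y Vky [Vy _]; move/eqP: k0; apply; exact: V_disjoint Vy Vky.
  (* [cov] is injective on [V], and [s] is its inverse there. Near a point of [C] it coincides with
     a continuous local section, so the lift is a continuous image of [C]. *)
  pose s p := if pselect ((@cov R @` V) p) is left h then projT1 (cid2 h) else z0.
  have sP p : (@cov R @` V) p -> V (s p) /\ cov (s p) = p.
    by rewrite /s; case: pselect => // h _; case: cid2.
  have sE z : V z -> s (cov z) = z.
    move=> Vz; have [|Vs sz] := sP (cov z); first by exists z.
    have [k kE] := cov_eq (esym sz).
    by rewrite kE (V_disjoint Vz (j := k)) ?shift0// -kE.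
  have -> : C0 = s @` C.
    apply/seteqP; split=> [z [Vz Cz]|_ [p Cp <-]]; first by exists (cov z) => //; exact: sE.
    have [Vs sp] := sP p (C_sub_V Cp); split=> //; by rewrite /= sp.
  apply: connected_continuous_connected => //; apply: continuous_in_subspaceT => p /set_mem Cp.
  have [z Vz zp] := C_sub_V Cp.
  have [t [G [oG Gz tz covt ct]]] := cov_section z.
  have tV : nbhs (cov z) (t @^-1` V).
    by apply: (ct _ Gz); rewrite tz; apply: open_nbhs_nbhs; split=> //; exact: open_V.
  have GG : nbhs (cov z) G by exact: open_nbhs_nbhs.
  have ts : \forall q \near cov z, t q = s q.
    by apply: filterS2 tV GG => q Vt Gq; rewrite -[in RHS](covt _ Gq) sE.
  rewrite -zp /continuous_at sE// -{2}tz.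
  by apply: cvg_trans (ct _ Gz); apply: near_eq_cvg.
- by move=> j z [Vz _] [Vj _]; exact: V_disjoint Vz Vj.
- move=> z; split=> [Cz|[k [_]]]; last by rewrite /= cov_shift.
  have [k Vk] := Vshift z Cz; exists k; split=> //=; by rewrite cov_shift.
- move=> z; have [Cz|nCz] := pselect (C (cov z)); last first.
    exists 0; apply: filterS (nclos z nCz) => y nCy j [_].
    by rewrite /= cov_shift => Cy; case: nCy.
  have [k Vkz] := Vshift z Cz; exists k.
  have : nbhs z (shift k @^-1` V) by apply: open_nbhs_nbhs.
  apply: filterS => y Vky j [Vj _]; apply/eqP; rewrite -subr_eq0; apply/eqP.
  apply: (V_disjoint Vky); rewrite shiftD; by have -> : k + (j - k) = j by lia.
- move=> M; have M1 : 0 < `|M| + 1 by rewrite ltr_pwDr.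
  have [z [w [? ? zM wM]]] := V_ends M1; exists z, w; split=> //.
    by have := ler_norm M; lra.
  by have := ler_norm M; lra.
Qed.

End LiftOfConnector.

Lemma connector_lift (R : realType) (C : set (annulus R)) : connector C -> ~ essential C ->
  exists C0 : set (R * R),
  [/\ closed C0 /\ connected C0, forall j z, C0 z -> C0 (shift j z) -> j = 0,
      forall z, C (cov z) <-> exists k, C0 (shift k z),
      forall z : R * R, exists k, \forall y \near z, forall j, C0 (shift j y) -> j = k
    & forall M, exists z w, [/\ C0 z, C0 w, z.1 <= - M & M <= w.1]].
Proof.
move=> [conC cloC endC] nC.
have [U [oU CU nU]] : exists U, [/\ open U, C `<=` U & ~ essential_open U].
  apply: contrapT => nU; apply: nC => U oU CU; apply: contrapT => eU.
  by apply: nU; exists U.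
have [p [q [Cp _ _ _]]] := endC 1 ltr01.
apply: (@connector_lift_aux R C U conC cloC endC oU CU nU (sec p)).
by rewrite secK.
Qed.

(** * The order of the translates of the connector *)

Section FirstHit.
Context (R : realType).
Notation P := (R * R)%type.

Lemma pconn_of_path (O : set P) (g : R -> P) s : continuous g ->
  (forall t, 0 <= t <= 1 -> O (g (t * s))) -> pconn O (g 0) (g s).
Proof.
move=> cg gO; exists (fun u => g (clamp u * s)); split.
- by cts.
- by move=> t /clamp_le0 ->; rewrite mul0r.
- by move=> t /clamp_ge1 ->; rewrite mul1r.
- by move=> t; apply: gO; exact: clamp_itv.
Qed.

(** On the segment from [z] to [w] the times spent in [D] have a least element, as [D] is closed.
    The set in the conclusion records that before [p] the path has not left the component of [z] in
    the complement of [D]. *)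
Lemma first_hit (D : set P) z w : closed D -> D w ->
  exists p, D p /\ pconn (pconn (~` D) z `|` [set p]) z p.
Proof.
move=> cD Dw; have [Dz|nDz] := pselect (D z).
  by exists z; split=> //; apply: pconn_refl; right.
have cg := @seg_continuous R z w.
set g := seg z w in cg; pose S := [set t | 0 <= t /\ D (g t)].
have S1 : S 1 by split; rewrite // /g seg1.
have lbS : has_lbound S by exists 0 => t [].
have iS : has_inf S by split; [exists 1|].
have i0 : 0 <= inf S by apply: lb_le_inf; [exists 1|move=> t []].
have Sinf t : 0 <= t -> t < inf S -> ~ D (g t).
  by move=> t0 tS Dt; have := ge_inf lbS (conj t0 Dt : S t); rewrite leNgt tS.
have Dinf : D (g (inf S)).
  apply: contrapT => nD.
  have : nbhs (inf S) (g @^-1` (~` D)).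
    by apply: cg; apply: open_nbhs_nbhs; split=> //; exact: closed_openC.
  move=> /nbhs_ballP[e /= e0 eD].
  have [t St te] := inf_adherent e0 iS.
  apply: (eD t _ St.2); rewrite /ball/= distrC ger0_norm ?ltrBlDl//.
  by rewrite subr_ge0; exact: ge_inf.
have z0 : g 0 = z by rewrite /g seg0.
exists (g (inf S)); split => //; rewrite -{2}z0.
apply: pconn_of_path => // t /andP[t0 t1].
have [->|tn1] := eqVneq (t * inf S) (inf S); first by right.
have tS : t * inf S < inf S by rewrite lt_neqAle tn1 ler_piMl.
left; rewrite -z0; apply: pconn_of_path => // u /andP[u0 u1] /=.
apply: Sinf; first by rewrite !mulr_ge0.
by apply: le_lt_trans tS; rewrite ler_piMl// mulr_ge0.
Qed.

Lemma closed_path (g : R -> P) : continuous g -> (forall t, g t = g (clamp t)) ->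
  closed (range g).
Proof.
move=> cg gc.
have -> : range g = g @` `[0, 1]%classic.
  apply/seteqP; split=> _ [t _ <-]; last by exists t.
  by exists (clamp t); rewrite -?gc//= in_itv/= clamp_itv.
apply: compact_closed; first by apply: prod_hausdorff; exact: R_hausdorff.
apply: continuous_compact; last exact: segment_compact.
exact: continuous_subspaceT.
Qed.

End FirstHit.

Section Order.
Context (R : realType).
Notation P := (R * R)%type.
Variable K0 : set P.
Hypotheses (cloK : closed K0) (conK : connected K0)
  (disK : forall j z, K0 z -> K0 (shift j z) -> j = 0)
  (locK : forall z : P, exists k, \forall y \near z, forall j, K0 (shift j y) -> j = k)
  (endK : forall M, exists z w, [/\ K0 z, K0 w, z.1 <= - M & M <= w.1]).

Definition translate (j : int) : set P := shift (- j) @^-1` K0.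
Notation Cj := translate.

Lemma translate_shift j k z : Cj (j + k) (shift k z) = Cj j z.
Proof. by rewrite /translate /= shiftD; congr (K0 (shift _ z)); lia. Qed.

Lemma translate0 z : Cj 0 z = K0 z.
Proof. by rewrite /translate /= oppr0 shift0. Qed.

Lemma translate_closed j : closed (Cj j).
Proof. by apply: preimage_closed => // z _; exact: shift_continuous. Qed.

Lemma translate_open j : open (~` Cj j).
Proof. by apply: closed_openC; exact: translate_closed. Qed.

Lemma translateE j : Cj j = shift j @` K0.
Proof.
apply/seteqP; split=> [z Kz|_ [z Kz <-]].
  by exists (shift (- j) z) => //; rewrite shiftD addNr shift0.
by rewrite /translate /= shiftD addrN shift0.
Qed.

Lemma translate_connected j : connected (Cj j).
Proof.
rewrite translateE; apply: connected_continuous_connected => //.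
by apply: continuous_subspaceT; exact: shift_continuous.
Qed.

Lemma translate_disjoint i j z : Cj i z -> Cj j z -> i = j.
Proof.
rewrite /translate /= => Ki Kj; have := disK Ki (j := i - j).
rewrite shiftD (_ : - i + (i - j) = - j); last by lia.
by move=> /(_ Kj) /eqP; rewrite subr_eq0 => /eqP.
Qed.

(** Near each point of the path at most one translate is present, and the path is compact. *)
Lemma translate_path_finite (g : R -> P) : continuous g ->
  exists J : nat, forall t, 0 <= t <= 1 -> forall j, Cj j (g t) -> (`|j| < J)%N.
Proof.
move=> cg.
have : near_covering (`[0, 1]%classic : set R).
  by apply/compact_near_coveringP; exact: segment_compact.
move=> /(_ _ (@nbhs nat _ \oo) (fun J t => forall j, Cj j (g t) -> (`|j| < J)%N) _) [].
  move=> t _; have [k nk] := locK (g t).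
  exists (g @^-1` [set y | forall j, K0 (shift j y) -> j = k], [set J | (`|k| < J)%N]) => /=.
    by split; [exact: cg|exists `|k|.+1%N].
  by move=> [u J] /= [uk kJ] j /uk; lia.
by move=> J _ /(_ J (leqnn J)) h; exists J => t t01; apply: h; rewrite /= in_itv.
Qed.

(** Subtracting the floor of [b] carries the point to the unit segment of the axis and onto the
    translate of number [- Num.floor b]; that segment meets only finitely many translates. *)
Lemma K0_axis_bounded : exists B : nat, forall b, K0 (0, b) -> `|b| < B%:R.
Proof.
have cg : continuous (fun t : R => ((0, t) : P)) by cts.
have [J HJ] := translate_path_finite cg; exists J.+1 => b Kb.
have f1 := floor_le b; have f2 := floorD1_gt b; rewrite intrD in f2.
have t01 : 0 <= b - (Num.floor b)%:~R <= 1 by apply/andP; split; lra.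
have := HJ _ t01 (- Num.floor b); rewrite /translate /shift /= opprK subrK => /(_ Kb).
move=> nJ; have : `|(Num.floor b)%:~R : R| <= J%:R - 1.
  rewrite -intr_norm -[J%:R]/(J%:~R) -[1]/(1%:~R) -intrB ler_int; lia.
rewrite ler_norml => /andP[? ?]; rewrite -natr1 ltr_norml; apply/andP; split; lra.
Qed.

Lemma K0_axis : exists b, K0 (0, b).
Proof.
have [z [w [Kz Kw z1 w1]]] := endK 1.
have /connected_intervalP itv : connected (fst @` K0).
  by apply: connected_continuous_connected => //; apply: continuous_subspaceT; exact: continuous_fst.
have z01 : z.1 <= 0 <= w.1 by apply/andP; split; lra.
have [[a b] Kab /= a0] := itv z.1 w.1 (ex_intro2 _ _ z Kz erefl) (ex_intro2 _ _ w Kw erefl) 0 z01.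
by exists b; rewrite -a0.
Qed.

Definition axis_bound : nat := projT1 (cid K0_axis_bounded).
Notation B := (axis_bound%:R : R).

Lemma axis_boundP b : K0 (0, b) -> `|b| < B.
Proof. by rewrite /axis_bound; case: cid => ? /=; apply. Qed.

Lemma axis_pt j b : Cj j (0, b) -> `|b - j%:~R| < B.
Proof. by rewrite /translate /shift /= mulrNz => /axis_boundP. Qed.

Lemma axis_left j b b' : b <= j%:~R - B -> b' <= j%:~R - B -> pconn (~` Cj j) (0, b) (0, b').
Proof.
move=> h h'; apply: pconn_seg => t /[dup] t01 /andP[t0 t1]; rewrite /seg /= clamp_id//.
have -> : 0 + t * (0 - 0) = 0 :> R by ring.
move=> /axis_pt; rewrite ltr_norml => /andP[]; nra.
Qed.

Lemma axis_right j b b' : j%:~R + B <= b -> j%:~R + B <= b' -> pconn (~` Cj j) (0, b) (0, b').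
Proof.
move=> h h'; apply: pconn_seg => t /[dup] t01 /andP[t0 t1]; rewrite /seg /= clamp_id//.
have -> : 0 + t * (0 - 0) = 0 :> R by ring.
move=> /axis_pt; rewrite ltr_norml => /andP[]; nra.
Qed.

(* [(0, j - B)] is on the axis, beyond all the points of [translate j] there. *)
Definition left_of (j : int) : set P := fun z => pconn (~` Cj j) z (0, j%:~R - B).
Notation L := left_of.

Lemma left_of_shift j k z : L (j + k) (shift k z) <-> L j z.
Proof.
have H i l y : L i y -> L (i + l) (shift l y).
  rewrite /left_of => h.
  have -> : (0, (i + l)%:~R - B) = shift l (0, i%:~R - B) :> P.
    by rewrite /shift /= intrD; congr pair; ring.
  apply: (pconn_map _ _ h); first exact: shift_continuous.
  by move=> x /=; rewrite translate_shift.
split; last exact: H.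
move=> /(H _ (- k)); rewrite shiftD addrN shift0.
by have -> : j + k + - k = j by lia.
Qed.

Lemma left_of_unshift j k z : L (j + k) z <-> L j (shift (- k) z).
Proof. by rewrite -(left_of_shift j k) shiftD addNr shift0. Qed.

Lemma left_of_pconn j z w : pconn (~` Cj j) z w -> L j z <-> L j w.
Proof. by move=> zw; split; apply: pconn_trans => //; exact: pconn_sym. Qed.

Lemma left_of_open j : open (L j).
Proof.
rewrite (_ : L j = pconn (~` Cj j) (0, j%:~R - B)).
  by apply: open_pconn; exact: translate_open.
by apply/seteqP; split => z; exact: pconn_sym.
Qed.

Lemma left_of_connected j (K : set P) x y : connected K -> (forall z, K z -> ~ Cj j z) ->
  K x -> K y -> L j x -> L j y.
Proof.
move=> cK Kj Kx Ky; apply: (iffLR (left_of_pconn _)).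
exact: (connected_pconn (@translate_open j) cK).
Qed.

Lemma left_of_axis_left j b : b <= j%:~R - B -> L j (0, b).
Proof. by move=> h; exact: axis_left. Qed.

(** A path avoiding [K0], prolonged by the two half axes beyond [B], would be a closed set [G] in a
    vertical strip, unbounded in both directions. As [K0] is connected and misses [G], a path in the
    complement of [G] would join far left to far right, and it would have to cross [G]. *)
Lemma K0_separates : ~ pconn (~` Cj 0) (0, - B) (0, B).
Proof.
move=> [g [cg g0 g1 gK]].
have gc t : g t = g (clamp t).
  have [t0|t0] := leP t 0; first by rewrite clamp_le0// !g0.
  have [t1|t1] := leP 1 t; first by rewrite clamp_ge1// !g1.
  by rewrite clamp_id// !ltW.
have cg1 : continuous (fun t => (g t).1) by cts.
have [M gM] : exists M, forall t, - M <= (g t).1 <= M.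
  by apply: path_bounded => // t; rewrite gc.
pose G := range g `|` [set z : P | z.1 = 0 /\ z.2 <= - B] `|` [set z : P | z.1 = 0 /\ B <= z.2].
have clG : closed G.
  have c1 : closed [set z : P | z.1 = 0].
    have -> : [set z : P | z.1 = 0] = fst @^-1` [set 0 : R] by [].
    apply: preimage_closed; [by move=> z _; exact: continuous_fst|exact: closed_eq].
  have c2 : closed [set z : P | z.2 <= - B].
    apply: (@preimage_closed _ _ snd [set t : R | t <= - B]); last exact: closed_le.
    by move=> z _; exact: continuous_snd.
  have c3 : closed [set z : P | B <= z.2].
    apply: (@preimage_closed _ _ snd [set t : R | B <= t]); last exact: closed_ge.
    by move=> z _; exact: continuous_snd.
  by apply: closedU; [apply: closedU; [exact: closed_path|exact: (closedI c1 c2)]|exact: (closedI c1 c3)].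
have KG : K0 `<=` ~` G.
  move=> z Kz [[[t _ tz]|[z1 z2]]|[z1 z2]].
  - by apply: (gK t); rewrite tz translate0.
  - have /axis_boundP : K0 (0, z.2) by rewrite -z1; case: (z) Kz.
    by rewrite ltr_norml; case/andP; lra.
  - have /axis_boundP : K0 (0, z.2) by rewrite -z1; case: (z) Kz.
    by rewrite ltr_norml; case/andP; lra.
have [z [w [Kz Kw zM wM]]] := endK (`|M| + 1).
have zw : pconn (~` G) z w by exact: connected_pconn (closed_openC clG) conK KG Kz Kw.
have MM := ler_norm M; have M0 := normr_ge0 M; have B0 : 0 <= B by exact: ler0n.
have [|T|p [Gp nGp]] := @pconn_cross R G (~` G) (`|M| + 1) z w _ _ zM wM zw; last by [].
  move=> y [[[t _ <-]|[-> _]]|[-> _]]; [|by apply/andP; split; lra..].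
  by have /andP[? ?] := gM t; apply/andP; split; lra.
exists (0, - (B + `|T|)), (0, B + `|T|); have TT := ler_norm T; have T0 := normr_ge0 T.
split => /=; [lra|lra|].
apply: (@pconn_trans _ _ _ (0, - B)).
  apply: pconn_seg => t /[dup] t01 /andP[t0 t1]; left; right.
  by rewrite /seg /= clamp_id//; split; [ring|nra].
apply: (@pconn_trans _ _ _ (0, B)).
  by exists g; split=> // t; left; left; exists t.
apply: pconn_seg => t /[dup] t01 /andP[t0 t1]; right.
by rewrite /seg /= clamp_id//; split; [ring|nra].
Qed.

Lemma left_of_axis_right j b : j%:~R + B <= b -> ~ L j (0, b).
Proof.
move=> h Lb; apply: K0_separates.
suff : L j (0, j%:~R + B).
  rewrite (_ : (0, j%:~R + B) = shift j (0, B)); last by rewrite /shift/= addrC.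
  rewrite -[X in L X]add0r => /left_of_shift; rewrite /left_of /= sub0r; exact: pconn_sym.
by apply/(left_of_pconn (axis_right h _)).
Qed.

Lemma left_of_or i j : i != j ->
  (forall z, Cj i z -> L j z) \/ (forall z, Cj i z -> ~ L j z).
Proof.
move=> ij; have [[z [Ciz Lz]]|nL] := pselect (exists z, Cj i z /\ L j z); [left=> w Ciw|right].
  apply: (left_of_connected (@translate_connected i) _ Ciz Ciw Lz) => y Ciy Cjy.
  by move/eqP: ij; apply; exact: translate_disjoint Ciy Cjy.
by move=> z Ciz Lz; apply: nL; exists z.
Qed.

(* A straight path coming from far away on the axis first meets one of the two
   translates, while still being on the same side of the other one. *)
Lemma first_translate z : exists p, (Cj 0 p /\ pconn (~` Cj 1) z p) \/ (Cj 1 p /\ pconn (~` Cj 0) z p).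
Proof.
have [b Kb] := K0_axis.
have clD : closed (Cj 0 `|` Cj 1) by apply: closedU; exact: translate_closed.
have [|p [Dp zp]] := @first_hit R _ z (0, b) clD; first by left; rewrite translate0.
have H i j : i != j -> (Cj 0 `|` Cj 1) = (Cj i `|` Cj j) -> Cj i p -> pconn (~` Cj j) z p.
  move=> ij DE Cip; apply: pconnW zp => y [/pconn_r nD Cjy|-> Cjp].
    by apply: nD; rewrite DE; right.
  by move/eqP: ij; apply; exact: translate_disjoint Cip Cjp.
exists p; case: Dp => [C0p|C1p]; [left|right]; split => //.
  exact: H C0p.
by apply: (H 1 0) C1p => //; rewrite setUC.
Qed.

(* Each translate is on the right of the previous one: otherwise the left sides
   would decrease, and [L 0] would contain translates far to the right. *)
Lemma left_of_step : (forall z, Cj 1 z -> ~ L 0 z) /\ (forall z, Cj 0 z -> L 1 z).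
Proof.
have B0 : 0 <= B by exact: ler0n.
have [b0 Kb0] := K0_axis.
have C0b : Cj 0 (0, b0) by rewrite translate0.
have Cnb (n : int) : Cj n (0, b0 + n%:~R).
  by have := translate_shift 0 n (0, b0); rewrite add0r => ->.
(* The starting point is on the left of both translates. The first one met is reached without
   touching the other, hence lies on the left of the other; [far_right] is the same with a start on
   the right. *)
have far_left : (forall z, Cj 0 z -> L 1 z) \/ (forall z, Cj 1 z -> L 0 z).
  have L0 : L 0 (0, - B) by apply: left_of_axis_left; lra.
  have L1 : L 1 (0, - B) by apply: left_of_axis_left; lra.
  have [p [[Cp zp]|[Cp zp]]] := first_translate (0, - B).
    left; have [//|/(_ p Cp)] := @left_of_or 0 1 isT.
    by case; apply/(left_of_pconn zp).
  right; have [//|/(_ p Cp)] := @left_of_or 1 0 isT.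
  by case; apply/(left_of_pconn zp).
have far_right : (forall z, Cj 0 z -> ~ L 1 z) \/ (forall z, Cj 1 z -> ~ L 0 z).
  have L0 : ~ L 0 (0, 1 + B) by apply: left_of_axis_right; lra.
  have L1 : ~ L 1 (0, 1 + B) by apply: left_of_axis_right; lra.
  have [p [[Cp zp]|[Cp zp]]] := first_translate (0, 1 + B).
    left; have [/(_ p Cp) Lp|//] := @left_of_or 0 1 isT.
    by case: L1; apply/(left_of_pconn zp).
  right; have [/(_ p Cp) Lp|//] := @left_of_or 1 0 isT.
  by case: L0; apply/(left_of_pconn zp).
have n10 : ~ (forall z, Cj 1 z -> L 0 z).
  move=> C1L0.
  have C0nL1 z : Cj 0 z -> ~ L 1 z.
    by case: far_right => [H|H]; [exact: H|case: (H _ (Cnb 1)); exact: C1L0 (Cnb 1)].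
  have L1L0 z : L 1 z -> L 0 z.
    move=> L1z; have zB : pconn (~` Cj 1) z (0, - B).
      by apply: (pconn_trans L1z); apply: axis_left; lra.
    have : pconn (~` Cj 0) z (0, - B).
      apply: pconnW (pconn_self zB) => y zy C0y; apply: (C0nL1 y C0y).
      by apply/(left_of_pconn zy).
    by move=> /left_of_pconn ->; apply: left_of_axis_left; lra.
  have LnL0 (n : nat) z : L n z -> L 0 z.
    elim: n z => [//|n IH] z Lz; apply: IH.
    rewrite -[n%:Z]add0r; apply/left_of_unshift/L1L0/left_of_unshift.
    by have -> : 1 + n%:Z = n.+1 by lia.
  pose n := Num.bound (`|b0| + B).
  have nP : `|b0| + B < n%:R by apply: archi_boundP; rewrite addr_ge0.
  have := ler_norm (- b0); rewrite normrN => b0n.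
  apply: (@left_of_axis_right 0 (b0 + (n.+1%:Z)%:~R)).
    by rewrite -[n.+1%:Z]natz natz -pmulrn -natr1; lra.
  apply: (LnL0 n); have := C1L0 _ (Cnb 1).
  move=> /(left_of_shift 0 n); rewrite add0r /shift /= -addrA -intrD.
  by have -> : 1 + n%:Z = n.+1 by lia.
split; last by case: far_left => // /n10.
by have [/n10|] := @left_of_or 1 0 isT.
Qed.

(** A path to the far left avoiding [translate 0] stays in [L 0], which [translate 1] does not meet;
    so it avoids [translate 1] as well. *)
Lemma left_of_mono1 j z : L j z -> L (j + 1) z.
Proof.
have [C1L0 _] := left_of_step; have B0 : 0 <= B by exact: ler0n.
have L0L1 y : L 0 y -> L 1 y.
  move=> L0y; have yB : pconn (~` Cj 0) y (0, - B).
    by apply: (pconn_trans L0y); apply: axis_left; lra.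
  have : pconn (~` Cj 1) y (0, - B).
    apply: pconnW (pconn_self yB) => x yx C1x; apply: (C1L0 x C1x).
    by apply/(left_of_pconn yx).
  by move=> /left_of_pconn ->; apply: left_of_axis_left; lra.
by move=> Lz; rewrite addrC; apply/left_of_unshift/L0L1/left_of_unshift; rewrite add0r.
Qed.

Lemma left_of_mono i j z : i <= j -> L i z -> L j z.
Proof.
move=> ij Li; have -> : j = i + `|j - i|%N by lia.
elim: `|j - i|%N => [|n IH]; first by rewrite addr0.
have -> : i + n.+1 = i + n + 1 by lia.
exact: left_of_mono1.
Qed.

Lemma translate_left j z : Cj (j - 1) z -> L j z.
Proof.
have [_ C0L1] := left_of_step.
rewrite /translate /= -translate0 => /C0L1 Lz.
have -> : j = 1 + (j - 1) by lia.
exact/left_of_unshift.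
Qed.

(** The segment from [z] to the origin meets finitely many translates, so for large [|j|] both ends
    are on the same side of [translate j]. For the origin the side is known once [|j|] is at least
    [axis_bound]. *)
Lemma left_of_bounded z : exists J : nat, L J z /\ ~ L (- J%:Z) z.
Proof.
have cg := @seg_continuous R z (0, 0).
have [J HJ] := translate_path_finite cg.
pose N := (J + axis_bound)%N.
have BN : B <= N%:R by rewrite ler_nat leq_addl.
have zC (j : int) : (J <= `|j|)%N -> pconn (~` Cj j) z (0, 0).
  by move=> Jj; apply: pconn_seg => t t01 /(HJ t t01 j); lia.
exists N; split.
  by apply/(left_of_pconn (zC N _)); [rewrite /N; lia|apply: left_of_axis_left; rewrite -pmulrn; lra].
move=> /(left_of_pconn (zC (- N%:Z) _)) => H.
apply: (@left_of_axis_right (- N%:Z) 0); first by rewrite mulrNz -pmulrn; lra.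
by apply: H; rewrite /N; lia.
Qed.

Lemma left_of_index z : exists n : int, forall j, L j z <-> n < j.
Proof.
have [J [LJ nLJ]] := left_of_bounded z.
have exn : exists n : nat, `[< L (- J%:Z + n) z >].
  by exists (J + J)%N; apply/asboolP; have -> : - J%:Z + (J + J)%N = J by lia.
case: (ex_minnP exn) => n /asboolP Ln nmin; exists (- J%:Z + n - 1) => j.
split=> [Lj|nj]; last by apply: left_of_mono Ln; lia.
rewrite ltNge; apply/negP => jn.
have [jJ|Jj] := leP j (- J%:Z); first by apply: nLJ; exact: left_of_mono Lj.
have := nmin (absz (j + J%:Z)); have -> : - J%:Z + absz (j + J%:Z) = j by lia.
by move=> /(_ (asboolT Lj)); lia.
Qed.

Definition index z : int := projT1 (cid (left_of_index z)).

Lemma indexP z j : L j z <-> index z < j.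
Proof. by rewrite /index; case: cid => ? /=; apply. Qed.

Lemma index_eq z n : ~ L n z -> L (n + 1) z -> index z = n.
Proof. by rewrite !indexP; lia. Qed.

Lemma index_shift k z : index (shift k z) = index z + k.
Proof.
apply: index_eq; first by move=> /left_of_shift /indexP; lia.
have -> : index z + k + 1 = index z + 1 + k by lia.
by apply/left_of_shift/indexP; lia.
Qed.

(** The index may drop by one near [z], when [z] is on the translate of number [index z], but not
    further: the preceding translate lies on the left of that one, hence misses [z], and points near
    [z] are on the same side of it. Openness of [left_of] excludes an increase. *)
Lemma index_near z : \forall y \near z, index z - 1 <= index y <= index z.
Proof.
have h1 : nbhs z (L (index z + 1)).
  by apply: open_nbhs_nbhs; split; [exact: left_of_open|apply/indexP; lia].
have nC : ~ Cj (index z - 1) z by move=> /translate_left /indexP; lia.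
have h2 : nbhs z (pconn (~` Cj (index z - 1)) z).
  by apply: open_nbhs_nbhs; split; [apply: open_pconn; exact: translate_open|exact: pconn_refl].
apply: filterS2 h1 h2 => y /indexP Ly zy.
have : ~ L (index z - 1) y by move=> /(left_of_pconn zy) /indexP; lia.
by move=> /indexP/negP; rewrite -leNgt => ?; lia.
Qed.

Lemma index_constant (K : set P) x y : connected K -> (forall z j, K z -> ~ Cj j z) ->
  K x -> K y -> index x = index y.
Proof.
move=> cK nK Kx Ky; have E j : L j x <-> L j y.
  by split; apply: left_of_connected cK _ _ _ => // z Kz; exact: nK.
by apply: index_eq; [move=> /E/indexP|apply/E/indexP]; lia.
Qed.

(** * Displacement of the index under the lifted map *)

Section Displacement.
Variables (F G : P -> P) (d : int).
Hypotheses (cF : continuous F) (cG : continuous G) (FK : cancel F G) (GK : cancel G F)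
  (Fshift : forall k z, F (shift k z) = shift (d * k) (F z))
  (freeF : forall i j z, Cj i z -> ~ Cj j (F z)) (d0 : d != 0).

Lemma G_shift k z : G (shift (d * k) z) = shift k (G z).
Proof. by apply: (can_inj FK); rewrite Fshift !GK. Qed.

Lemma index_F_translate : exists n0, forall j z, Cj j z -> index (F z) = n0 + d * j.
Proof.
have [z0 [_ [Kz0 _ _ _]]] := endK 0; exists (index (F z0)) => j z.
rewrite translateE => -[w Kw <-]; rewrite Fshift index_shift; congr (_ + _).
apply: (@index_constant (F @` K0)).
- by apply: connected_continuous_connected => //; exact: continuous_subspaceT.
- by move=> _ i [y Ky <-]; apply: (@freeF 0); rewrite translate0.
- by exists w.
- by exists z0.
Qed.

(** [G] commutes only with shifts by multiples of [d], so unlike for [F] no affine formula in [i] is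
    available; by freeness [G] sends [translate i] to a connected set missing all translates. *)
Lemma index_G_translate i : exists k, forall z, Cj i z -> index (G z) = k.
Proof.
have [z0 [_ [Kz0 _ _ _]]] := endK 0; exists (index (G (shift i z0))) => z Cz.
apply: (@index_constant (G @` Cj i)).
- apply: connected_continuous_connected; first exact: translate_connected.
  exact: continuous_subspaceT.
- by move=> _ j [y Cy <-] /freeF; apply; rewrite GK; exact: Cy.
- by exists z.
- by exists (shift i z0) => //; rewrite translateE; exists z0.
Qed.

(* If [C_i] has [F z] on one side and both [F C_0], [F C_1] on the other one,
   then a path from [F z] to [C_i] avoids [F C_0] and [F C_1]; pulled back by [F]
   it shows that [G C_i] lies between [C_0] and [C_1], like [z]. *)
Lemma index_G_separating i z : index z = 0 ->
  (forall k y, k = 0 \/ k = 1 -> Cj k y -> ~ (L i (F z) <-> L i (F y))) ->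
  forall y, Cj i y -> index (G y) = 0.
Proof.
move=> z0 side y Ciy.
have [p [Cp zp]] := @first_hit R (Cj i) (F z) y (@translate_closed i) Ciy.
(* The index is the same at all points of [G (translate i)], so [y] may be replaced by the first
   point [p] met on the way from [F z]. *)
have [k kP] := index_G_translate i; rewrite (kP y Ciy) -(kP p Cp).
have zGp l : l = 0 \/ l = 1 -> pconn (~` Cj l) z (G p).
  move=> l01; rewrite -[z]FK; apply: (pconn_map cG _ zp) => x xP ClGx.
  case: xP => [xz|xp].
    apply: (side l (G x)) => //; rewrite GK; exact: left_of_pconn.
  by apply: (@freeF l i (G x)) => //; rewrite GK xp.
apply: index_eq.
  move=> /(left_of_pconn (zGp 0 (or_introl erefl))) /indexP; lia.
apply/(left_of_pconn (zGp 1 (or_intror erefl)))/indexP; lia.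
Qed.

Lemma index_displacement : exists K : int, forall z, `|index (F z) - d * index z| <= K.
Proof.
have [n0 n0P] := index_F_translate.
exists (`|n0| + 2 * `|d|) => z0; pose z := shift (- index z0) z0.
(* Translating [z0] to index 0 leaves the displacement unchanged, by equivariance of [F] and of the
   index. *)
have z00 : index z = 0 by rewrite /z index_shift; lia.
have -> : index (F z0) - d * index z0 = index (F z).
  by rewrite /z Fshift index_shift; lia.
suff H : `|index (F z) - n0| <= 2 * `|d| by lia.
have [w [_ [Kw _ _ _]]] := endK 0.
have side i : (index (F z) < i /\ i <= n0 - `|d|) \/ (i <= index (F z) /\ n0 + `|d| < i) ->
    index (G (shift i w)) = 0.
  move=> iP; apply: (@index_G_separating i z z00); last by rewrite translateE; exists w.
  by move=> k y k01 Cy; rewrite !indexP (n0P _ _ Cy); case: k01 => ->; lia.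
have step i e : index (G (shift (i + d * e) w)) = index (G (shift i w)) + e.
  by rewrite -shiftD G_shift index_shift.
rewrite leNgt; apply/negP => far.
have [Iz|Iz] := leP (index (F z)) n0.
  have h1 : index (G (shift (n0 - `|d|) w)) = 0 by apply: side; lia.
  have h2 : index (G (shift (n0 - `|d| - `|d|) w)) = 0 by apply: side; lia.
  have := step (n0 - `|d|) (- sgz d); rewrite h1 add0r.
  have -> : n0 - `|d| + d * - sgz d = n0 - `|d| - `|d| by rewrite mulrN mulrC -abszEsg; lia.
  by rewrite h2; lia.
have h1 : index (G (shift (n0 + `|d| + 1) w)) = 0 by apply: side; lia.
have h2 : index (G (shift (n0 + `|d| + 1 + `|d|) w)) = 0 by apply: side; lia.
have := step (n0 + `|d| + 1) (sgz d); rewrite h1 add0r.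
have -> : n0 + `|d| + 1 + d * sgz d = n0 + `|d| + 1 + `|d| by rewrite mulrC -abszEsg; lia.
by rewrite h2; lia.
Qed.

End Displacement.

End Order.

(** * The semiconjugacy *)

Section Limit.
Context (R : realType).
Notation P := (R * R)%type.

(** [K / 2 ^ n] is the sum of the bounds on all later steps, so the intervals of that radius around
    [a n] are nested, and the infimum of their upper ends lies in all of them. The explicit rate
    serves to compare limits later. *)
Lemma geometric_limit (a : nat -> R) (K : R) :
  (forall n, `|a n.+1 - a n| <= K / 2 ^+ n.+1) -> exists h, forall n, `|h - a n| <= K / 2 ^+ n.
Proof.
move=> aK.
have K2 n : K / 2 ^+ n = K / 2 ^+ n.+1 + K / 2 ^+ n.+1.
  by rewrite exprSr invfM mulrA -mulrDr -[RHS]mulr1; field.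
have Kn n : 0 <= K / 2 ^+ n by rewrite K2 addr_ge0// (le_trans _ (aK n)).
pose u n := a n + K / 2 ^+ n; pose v n := a n - K / 2 ^+ n.
have uS n m : (n <= m)%N -> u m <= u n.
  elim: m => [|m IH]; first by rewrite leqn0 => /eqP ->.
  rewrite leq_eqVlt => /predU1P[->//|nm]; apply: le_trans (IH nm).
  by have := aK m; have := K2 m; rewrite ler_norml /u => ? /andP[? ?]; lra.
have vS n m : (n <= m)%N -> v n <= v m.
  elim: m => [|m IH]; first by rewrite leqn0 => /eqP ->.
  rewrite leq_eqVlt => /predU1P[->//|nm]; apply: le_trans (IH nm) _.
  by have := aK m; have := K2 m; rewrite ler_norml /v => ? /andP[? ?]; lra.
have vu n m : v n <= u m.
  apply: le_trans (vS n (maxn n m) (leq_maxl _ _)) _.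
  apply: le_trans (uS m (maxn n m) (leq_maxr _ _)).
  by rewrite /u /v lerD2l; have := Kn (maxn n m); lra.
have lbu : has_lbound (range u) by exists (v 0%N) => _ [m _ <-].
exists (inf (range u)) => n.
have h1 : inf (range u) <= u n by apply: ge_inf => //; exists n.
have h2 : v n <= inf (range u) by apply: lb_le_inf; [exists (u 0%N), 0%N|move=> _ [m _ <-]].
by move: h1 h2; rewrite /u /v ler_norml => ? ?; apply/andP; split; lra.
Qed.

Lemma pow2_small (K e : R) : 0 <= K -> 0 < e -> exists n, K / 2 ^+ n < e.
Proof.
move=> K0 e0; have e1 : 0 < e / (K + 1) by rewrite divr_gt0// ltr_pwDr.
have [N _ HN] := @near_infty_natSinv_expn_lt R (PosNum e1).
exists N; have := HN N (leqnn N); rewrite /= div1r ltr_pdivlMr ?ltr_pwDr// => h.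
by apply: le_lt_trans h; rewrite mulrC ler_pM2l ?invr_gt0 ?exprn_gt0// lerDl.
Qed.

Lemma pow2_eq (K x y : R) : 0 <= K -> (forall n, `|x - y| <= K / 2 ^+ n) -> x = y.
Proof.
move=> K0 xy; apply/eqP; rewrite -subr_eq0 -normr_eq0; apply/negPn/negP => n0.
have [|n] := @pow2_small K `|x - y| K0; first by rewrite lt_neqAle eq_sym n0 normr_ge0.
by rewrite ltNge xy.
Qed.

Lemma rotation_limit (F : P -> P) (ind : P -> int) (d K : int) :
  continuous F -> 1 < `|d| -> (forall k z, F (shift k z) = shift (d * k) (F z)) ->
  (forall k z, ind (shift k z) = ind z + k) ->
  (forall z, \forall y \near z, ind z - 1 <= ind y <= ind z) ->
  (forall z, `|ind (F z) - d * ind z| <= K) ->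
  exists H : P -> R, [/\ continuous H, forall k z, H (shift k z) = H z + k%:~R &
    forall z, H (F z) = d%:~R * H z].
Proof.
move=> cF d1 Fs inds indn indK.
(* An integer with [1 < |d|] has [2 <= |d|], so powers of 2 bound all the denominators. *)
have d2 : 2 <= `|d%:~R| :> R by rewrite -intr_norm -[2]/(2%:~R) ler_int; lia.
have d0 : d%:~R != 0 :> R by rewrite -normr_gt0; lra.
have K0 : 0 <= K by apply: le_trans (indK (0, 0)).
have K0R : 0 <= (K%:~R : R) by rewrite ler0z.
have dn n : 2 ^+ n <= `|d%:~R| ^+ n :> R by rewrite lerXn2r ?nnegrE//; lra.
have dninv n : `|(d%:~R ^+ n)^-1| <= (2 ^+ n)^-1 :> R.
  by rewrite normfV normrX lef_pV2 ?posrE ?exprn_gt0//; lra.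
pose a (z : P) n : R := (ind (iter n F z))%:~R / d%:~R ^+ n.
have aS z n : `|a z n.+1 - a z n| <= K%:~R / 2 ^+ n.+1.
  have -> : a z n.+1 - a z n = (ind (iter n.+1 F z) - d * ind (iter n F z))%:~R / d%:~R ^+ n.+1.
    by rewrite /a rmorphB rmorphM /= exprS; field; rewrite d0 expf_neq0.
  rewrite normrM; apply: ler_pM => //.
  by rewrite -intr_norm ler_int; exact: indK.
have /choice[H Ha] z := geometric_limit (aS z).
have iterS n k z : iter n F (shift k z) = shift (d ^+ n * k) (iter n F z).
  elim: n => [|n IH]; first by rewrite mul1r.
  by rewrite !iterS IH Fs exprS mulrA.
exists H; split.
- move=> z; apply/(@cvgrPdist_lt _ _ _ _ (nbhs_filter z)) => e e0.
  (* [2 * K + 1] collects the errors [K / 2 ^ n] at [z] and at [y], and the jump of the index at the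
     [n]-th iterate, at most 1 before division by [d ^ n]. *)
  have K21 : 0 <= 2 * K%:~R + 1 :> R by rewrite addr_ge0// mulr_ge0.
  have [n ne] := pow2_small K21 e0.
  have cFn : continuous (iter n F).
    by elim: n {ne} => [|n IH]; [exact: continuous_id|exact: (continuousT_comp IH cF)].
  have nz := cFn z _ (indn (iter n F z)).
  apply: (@filterS _ _ (@nbhs_filter P z) _ _ _ nz) => y /= yz.
  have ayz : `|a z n - a y n| <= 1 / 2 ^+ n.
    rewrite /a -mulrBl normrM; apply: ler_pM => //.
    by rewrite -intrB -intr_norm -[1]/(1%:~R) ler_int; lia.
  have := Ha z n; have := Ha y n; rewrite [ltLHS]mulrDl -mulrA in ne.
  have -> : H z - H y = (H z - a z n) + (a z n - a y n) - (H y - a y n) by ring.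
  have := ler_normD (H z - a z n) (a z n - a y n).
  have := ler_normB (H z - a z n + (a z n - a y n)) (H y - a y n).
  by lra.
- move=> k z; apply: (@pow2_eq (2 * K%:~R)) => [|n]; first by rewrite mulr_ge0.
  have aE : a (shift k z) n = a z n + k%:~R.
    by rewrite /a iterS inds rmorphD rmorphM rmorphXn /= mulrDl mulrAC divff ?mul1r// expf_neq0.
  have -> : H (shift k z) - (H z + k%:~R) = (H (shift k z) - a (shift k z) n) - (H z - a z n).
    by rewrite aE; ring.
  have := Ha z n; have := Ha (shift k z) n.
  have := ler_normB (H (shift k z) - a (shift k z) n) (H z - a z n).
  by rewrite -mulrA; lra.
- move=> z; apply: (@pow2_eq ((1 + `|d%:~R|) * K%:~R)) => [|n]; first by rewrite mulr_ge0 ?addr_ge0.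
  have aE : a (F z) n = d%:~R * a z n.+1.
    by rewrite /a -iterSr exprS; field; rewrite d0 expf_neq0.
  have -> : H (F z) - d%:~R * H z = (H (F z) - a (F z) n) - d%:~R * (H z - a z n.+1).
    by rewrite aE; ring.
  apply: le_trans (ler_normB _ _) _; rewrite -mulrA mulrDl mul1r normrM.
  apply: lerD; first exact: Ha.
  apply: ler_wpM2l => //; apply: le_trans (Ha z n.+1) _.
  by apply: ler_wpM2l => //; rewrite lef_pV2 ?posrE ?exprn_gt0// exprS ler_peMl// ?exprn_ge0//; lra.
Qed.

End Limit.

(** * Descent of the limit to the annulus *)

Section Semiconjugacy.
Context (R : realType).
Notation P := (R * R)%type.
Notation A := (annulus R).

Lemma eR_val_add (x y : R) :
  (\val (eR (x + y)) : R[i]) = (\val (eR x) : R[i]) * (\val (eR y) : R[i]).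
Proof.
rewrite !circle_valE !cX_eR !cY_eR mulrDr cosD sinD.
by rewrite /GRing.mul /=; congr Complex; rewrite addrC.
Qed.

Lemma eR_val0 : (\val (eR (0 : R)) : R[i]) = 1.
Proof. by rewrite circle_valE cX_eR cY_eR mulr0 cos0 sin0. Qed.

Lemma eR_pow (d : int) (x : R) : eR (d%:~R * x) = circle_pow d (eR x).
Proof.
have nat_case (n : nat) : (\val (eR (n%:R * x)) : R[i]) = (\val (eR x) : R[i]) ^+ n.
  elim: n => [|n IH]; first by rewrite mul0r eR_val0.
  by rewrite -natr1 mulrDl mul1r eR_val_add IH exprSr.
apply: val_inj; case: d => n; first exact: nat_case.
have -> : (Negz n)%:~R = - n.+1%:R :> R by rewrite NegzE mulrNz.
have := eR_val_add (- n.+1%:R * x) (n.+1%:R * x).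
rewrite mulNr addNr eR_val0 nat_case => E.
have v0 : (\val (eR x) : R[i]) ^+ n.+1 != 0.
  by apply/eqP => v0; move: E; rewrite v0 mulr0 => /eqP; rewrite oner_eq0.
apply: (mulIf v0); rewrite -[RHS]/(((\val (eR x) : R[i]) ^+ n.+1)^-1 * _) mulVf//.
Qed.

Lemma H1_map_id (X : topologicalType) (h : continuousType X X) (u : H1 R X) :
  (forall x, h x = x) -> H1_map h u = u.
Proof.
move=> hE; have [z ->] := H1_classK u; rewrite H1_mapE; congr H1_class; apply: val_inj => /=.
elim/chain_ind: (cycle_chain z) => [|a b Qa Qb|a Qa|s]; rewrite ?raddf0//.
- by rewrite !raddfD/= Qa Qb.
- by rewrite !raddfN/= Qa.
- by rewrite !chain_map1; congr << _ >>; apply/continuousEP => t /=; rewrite hE.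
Qed.

(** Injectivity is read off the multiples of the core. For surjectivity, the circle is embedded in
    the annulus as a section [i] of [angle_map]; winding numbers show that [i] sends the image of
    the core under [h] back to the core, so [h] and [angle_map] agree on the core, and [angle_map]
    is onto in homology. *)
Lemma winding_bijective (h : continuousType A (circle R)) :
  windH (H1_map h (core_class R)) = 1 -> bijective (@H1_map R _ _ h).
Proof.
move=> h1.
have inj : injective (@H1_map R _ _ h).
  move=> u v; have [k ->] := H1_core u; have [l ->] := H1_core v.
  by rewrite !raddfMz => /(congr1 (@windH R)); rewrite !windHMz h1 => /intr_inj ->.
have ci : continuous (fun z : circle R => ((cov (origin R)).1, z) : A).
  by apply: continuous_pair; [exact: continuous_const|exact: continuous_id].
pose i : continuousType (circle R) A := mkcts ci.
have pi_ (v : H1 R (circle R)) : H1_map (angle_map R) (H1_map i v) = v.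
  have cid_ := @continuous_id (circle R).
  by rewrite (@H1_map_comp _ _ _ _ _ _ (mkcts cid_))// H1_map_id.
have hp : H1_map h (core_class R) = H1_map (angle_map R) (core_class R).
  rewrite -[LHS]pi_; congr (H1_map _ _); apply: winding_inj.
  by rewrite winding_core /winding pi_.
have /choice[g gK] : forall v : H1 R (circle R), exists u : H1 R A, H1_map h u = v.
  move=> v; have [k kE] := H1_core (H1_map i v); exists (core_class R *~ k).
  by rewrite raddfMz/= hp -raddfMz -kE; exact: pi_.
exists g => // u; exact/inj/gK.
Qed.

(** [eR] of [H] at a preimage does not depend on the preimage, since [H] changes by an integer;
    local sections of [cov] then give continuity. The core has image of winding number 1 because [H]
    grows by 1 under [shift 1]. *)
Lemma semiconjugacy_of_lift (f : A -> A) (d : int) (F : P -> P) (H : P -> R) :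
  continuous H -> (forall k z, H (shift k z) = H z + k%:~R) ->
  (forall z, cov (F z) = f (cov z)) -> (forall z, H (F z) = d%:~R * H z) ->
  exists h : continuousType A (circle R), semiconjugacy f d h.
Proof.
move=> cH Hs Ff HF.
pose h0 p := eR (H (sec p)).
have hE z : h0 (cov z) = eR (H z).
  have [k kE] := @cov_eq R z (sec (cov z)) (esym (secK _)).
  by rewrite /h0 kE Hs eR_int.
have ch0 : continuous h0.
  move=> p; rewrite -(secK p); set z := sec p.
  have [s [G [oG Gz sz covs cs]]] := cov_section z.
  have GG : nbhs (cov z) G by exact: open_nbhs_nbhs.
  have c : {for cov z, continuous (fun q => eR (H (s q)))}.
    have cHe := continuousT_comp cH (@eR_continuous R).
    apply: (@continuous_comp _ _ _ s (fun y => eR (H y))); first exact: cs.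
    exact: cHe.
  have E : \forall q \near cov z, eR (H (s q)) = h0 q.
    by apply: filterS GG => q Gq; rewrite -[in RHS](covs _ Gq) hE.
  rewrite /continuous_at hE -{2}sz.
  by apply: cvg_trans c; apply: near_eq_cvg.
exists (mkcts ch0); split.
  have key z : h0 (f (cov z)) = circle_pow d (h0 (cov z)) by rewrite -Ff !hE HF eR_pow.
  by move=> p; have := key (sec p); rewrite secK.
apply: winding_bijective.
have cm := continuousT_comp (@mix_continuous R (origin R) (shift 1 (origin R))) (@cov_continuous R).
have chm := continuousT_comp cm ch0.
have e01 : h0 (cov (mix (origin R) (shift 1 (origin R)) 0)) = h0 (cov (mix (origin R) (shift 1 (origin R)) 1)).
  by rewrite core_loop_subproof.
have cHm := continuousT_comp (@mix_continuous R (origin R) (shift 1 (origin R))) cH.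
rewrite /core_class (@H1_map_loop _ _ _ _ _ _ _ _ chm e01)// (windH_loop _ _ cHm)//.
have -> : mix (origin R) (shift 1 (origin R)) 1 = shift 1 (origin R) by rewrite /mix /shift /=; congr pair; ring.
have -> : mix (origin R) (shift 1 (origin R)) 0 = origin R by rewrite /mix /shift /=; congr pair; ring.
by rewrite Hs addrC addKr.
Qed.

End Semiconjugacy.

Theorem corollary7 (R : realType) (d : int)
  (f : continuousType (annulus R) (annulus R)) :
  1 < `|d| ->
  covering_map f ->
  degree f d ->
  (exists C : set (annulus R), [/\ connector C, ~ essential C & free_set f C]) ->
  exists h : continuousType (annulus R) (circle R), semiconjugacy f d h.
Proof.
move=> d1 fcov fdeg [C [conC nC freeC]].
have [F [G [[cF cG] FK GK Ff Fs]]] := covering_lift_homeo fcov fdeg.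
have [K0 [[cloK conK] disK CK locK endK]] := connector_lift conC nC.
have d0 : d != 0 by apply/eqP => d0; rewrite d0 in d1.
have freeK i j z : translate K0 i z -> ~ translate K0 j (F z).
  move=> Ki Kj.
  have : (f @` C `&` C) (cov (F z)).
    split; last by apply/CK; exists (- j).
    by exists (cov z); [apply/CK; exists (- i)|rewrite Ff].
  by rewrite freeC.
have [K KP] := index_displacement cloK conK disK locK endK cF cG FK GK Fs freeK d0.
have [H [cH Hs HF]] := rotation_limit cF d1 Fs (index_shift cloK conK disK locK endK)
  (index_near cloK conK disK locK endK) KP.
exact: semiconjugacy_of_lift cH Hs Ff HF.
Qed.
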